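(* Let $\sigma,\omega$ be two weights on $\mathbb{R}^{d}$, let $\Phi_{1},\dots,\Phi_{n} \in \mathcal{U}\cap \nabla_{2}$ and $\Psi \in \widetilde{\mathcal{U}}$. Assume that $\Phi:\mathbb{R}_{+} \to \mathbb{R}_{+}$ is a bijection such that $\Phi^{-1}=\Phi_{1}^{-1}\times\cdots\times \Phi_{n}^{-1}$ (pointwise product) and $t\mapsto \frac{\Psi(t)}{\Phi(t)}$ is increasing on $\mathbb{R}_{+}^{*}$. Let $\vec{\sigma}=(\sigma,\dots,\sigma)$ ($n$ entries), put $\nu_{\vec{\sigma}}:= \frac{1}{\Phi\left(\prod_{i=1}^{n}\Phi_{i}^{-1}\left(\frac{1}{\sigma}\right)\right)}$ (which equals $\sigma$) and $$[\vec{\sigma},\omega]_{M_{\vec{\Phi},\Psi}}:=\sup_{Q\in \mathcal{Q}}\omega(Q)\,\Psi \circ \Phi^{-1}\left( \frac{1}{\nu_{\vec{\sigma}}(Q)}\right).$$ If $\sigma$ is doubling, then the following are equivalent: (i) $[\vec{\sigma},\omega]_{M_{\vec{\Phi},\Psi}}<\infty$; (ii) $\mathcal{M}_{\vec{\sigma}}: L^{\Phi_{1}}(\sigma) \times\cdots\times L^{\Phi_{n}}(\sigma)\to L^{\Psi}(\omega)$ is bounded. Moreover, $$\|\mathcal{M}_{\vec{\sigma}}\|_{\prod_{i=1}^{n}L_{\sigma}^{\Phi_{i}}\to L_{\omega}^{\Psi}} \approx \Psi^{-1}\left( [\vec{\sigma},\omega]_{M_{\vec{\Phi},\Psi}}\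right).$$
   Context: $\mathbb{R}_+=[0,\infty)$, $\mathbb{R}_+^*=(0,\infty)$. $\mathcal{Q}$ is the set of non-degenerate cubes in $\mathbb{R}^d$ with sides parallel to the axes; $\ell(Q)$ is the sidelength of $Q$. A weight is a locally integrable, almost everywhere positive function $\sigma$ on $\mathbb{R}^d$; $\sigma(E)=\int_E\sigma(x)\,dx$. A weight $\sigma$ is doubling if there is $C>1$ such that for all $Q,Q'\in\mathcal{Q}$ with $Q\subset Q'$, $\ell(Q')\le2\ell(Q)$ implies $\sigma(Q')\le C\sigma(Q)$. The weighted multilinear maximal function for $\vec\sigma=(\sigma_1,\dots,\sigma_n)$ is $$\mathcal{M}_{\vec{\sigma}}(f_1,\dots,f_n)(x):= \sup_{Q \in \mathcal{Q}}\prod_{i=1}^{n}\frac{\chi_{Q}(x)}{\sigma_{i}(Q)}\int_{Q}|f_{i}(y)|\sigma_{i}(y)\,dy .$$ A growth function is a function $\Phi:\mathbb{R}_+\to\mathbb{R}_+$, not identically zero, continuous, nondecreasing and onto. It is of upper-type $q>0$ if there is $C_q>0$ with $\Phi(st)\le C_q t^q\Phi(s)$ for all $s>0$, $t\ge 1$. For $q\ge1$, $\mathcal{U}^q$ is the set of growth functions of upper-type $q$ such that $t\mapsto\Phi(t)/t$ is nondecreasing on $\mathbb{R}_+^*$; $\mathcal{U}=\bigcup_{q\ge1}\mathcal{U}^q$. Standing convention: (up to replacing it by an equivalent function) every $\Phi\in\mathcal{U}$ is assumed convex, of class $C^1$, with $\Phi'(t)\approx\Phi(t)/t$ for $t>0$.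 $\Phi\in\Delta'$: there is $C>0$ with $\Phi(st)\le C\Phi(s)\Phi(t)$ for all $s,t>0$. $\Phi\in\Delta_2$: there is $K>0$ with $\Phi(2t)\le K\Phi(t)$ for all $t>0$. For a convex growth function $\Phi\in\Delta_2$, $\Phi\in\nabla_2$ means there is $C>0$ with $\int_0^t\frac{\Phi(s)}{s^2}ds\le C\frac{\Phi(t)}{t}$ for all $t>0$. For $q\ge1$, $\widetilde{\mathcal{U}}^q$ is the set of $\Phi\in\mathcal{U}^q\cap\Delta'$ for which there is $C>0$ with $\Phi(s/t)\le C\,\Phi(s)/t^q$ for all $s,t\ge1$; $\widetilde{\mathcal{U}}=\bigcup_{q\ge1}\widetilde{\mathcal{U}}^q$. For $\Phi\in\mathcal{U}$ and a weight $\sigma$, $L^\Phi(\sigma)$ is the set of (classes of) measurable $f:\mathbb{R}^d\to\mathbb{C}$ with $\|f\|_{L^\Phi_\sigma}^{lux}:=\inf\{\lambda>0:\int_{\mathbb{R}^d}\Phi(|f(x)|/\lambda)\sigma(x)dx\le1\}<\infty$. An operator $T:L^{\Phi_1}(\sigma_1)\times\cdots\times L^{\Phi_n}(\sigma_n)\to L^\Psi(\omega)$ is bounded if there is $C>0$ with $\|T(f_1,\dots,f_n)\|^{lux}_{L^\Psi_\omega}\le C\prod_{j}\|f_j\|^{lux}_{L^{\Phi_j}_{\sigma_j}}$ for all $f_j\in L^{\Phi_j}(\sigma_j)$; $\|T\|_{\prod_j L^{\Phi_j}_{\sigma_j}\to L^\Psi_\omega}$ is the infimum of such $C$. $A\approx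 B$ means $c^{-1}B\le A\le cB$ with a constant $c>0$ depending only on $n$, $\sigma$, $\Psi$, $\Phi_1,\dots,\Phi_n$ (not on $\omega$). *)

(* Defs.v *)
From HB Require Import structures.
From mathcomp Require Import all_boot all_order all_algebra.
From mathcomp Require Import all_classical all_reals all_analysis.
From mathcomp Require Import complex.
Set Implicit Arguments.
Unset Strict Implicit.
Unset Printing Implicit Defensive.
Import Order.TTheory GRing.Theory Num.Theory.
Import numFieldNormedType.Exports.

Local Open Scope classical_set_scope.
Local Open Scope ring_scope.

(** * Lebesgue measure on R^d *)

Section cons_map.
Context {R : realType} (d : nat).

Definition tcons (p : measurableTypeR R * d.-tuple R) : d.+1.-tuple R :=
  [the d.+1.-tuple R of p.1 :: p.2].

Lemma measurable_tcons : measurable_fun setT tcons.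
Proof. by apply: measurable_cons. Qed.

Section step.
Variable m : {sigma_finite_measure set (d.-tuple R) -> \bar R}.

Definition lebesgue_step : set (d.+1.-tuple R) -> \bar R :=
  pushforward (lebesgue_measure \x m)%E tcons.

Let step0 : lebesgue_step set0 = 0%E.
Proof. by rewrite /lebesgue_step /pushforward preimage_set0 measure0. Qed.

Let step_ge0 A : (0 <= lebesgue_step A)%E.
Proof. by apply: integral_ge0 => x _; exact: measure_ge0. Qed.

Let step_sigma_additive : semi_sigma_additive lebesgue_step.
Proof.
move=> F mF tF mUF; rewrite /lebesgue_step /pushforward preimage_bigcup.
have mtF n : measurable (tcons @^-1` F n).
  by rewrite -[X in measurable X]setTI; exact: measurable_tcons.
apply: measure_semi_sigma_additive => //.
  apply/trivIsetP => /= i j _ _ ij; rewrite -preimage_setI.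
  by move/trivIsetP : tF => /(_ _ _ _ _ ij) ->//; rewrite preimage_set0.
exact: bigcupT_measurable.
Qed.

HB.instance Definition _ := isMeasure.Build _ _ _ lebesgue_step
  step0 step_ge0 step_sigma_additive.

Lemma lebesgue_step_sigma_finite : sigma_finite setT lebesgue_step.
Proof.
have /sigma_finiteP[F [TF ndF Foo]] := sigma_finiteT (@lebesgue_measure R).
have /sigma_finiteP[G [TG ndG Goo]] := sigma_finiteT m.
pose H k : set (measurableTypeR R * d.-tuple R) := F k `*` G k.
pose untcons (z : d.+1.-tuple R) : measurableTypeR R * d.-tuple R :=
  (thead z, [tuple of behead z]).
have untconsK p : untcons (tcons p) = p.
  case: p => a b; rewrite /untcons theadE; congr pair.
  exact: val_inj.
exists (fun k => untcons @^-1` H k).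
  apply/esym; rewrite -subTset => z _.
  have [k _ Fk] : (\bigcup_k F k) (thead z) by rewrite -TF.
  have [l _ Gl] : (\bigcup_k G k) [tuple of behead z] by rewrite -TG.
  exists (maxn k l) => //; split => /=.
  - by move: Fk; exact/subsetPset/ndF/leq_maxl.
  - by move: Gl; exact/subsetPset/ndG/leq_maxr.
move=> k; have [mF Fk] := Foo k; have [mG Gk] := Goo k.
have mH : measurable (H k) by exact: measurableX.
split.
  have mu : measurable_fun setT untcons.
    apply: measurable_fun_pair.
    + exact: measurable_tnth.
    + exact: measurable_behead.
  by rewrite -[X in measurable X]setTI; exact: mu.
rewrite /lebesgue_step /pushforward.
rewrite [X in product_measure1 _ _ X](_ : _ = H k); last first.
  by apply/seteqP; split=> p /=; rewrite untconsK.
by rewrite product_measure1E// lte_mul_pinfty// ge0_fin_numE.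
Qed.

HB.instance Definition _ :=
  @Measure_isSigmaFinite.Build _ _ _ lebesgue_step lebesgue_step_sigma_finite.

End step.
End cons_map.

Fixpoint borel_lebesgue (R : realType) (d : nat) :
    {sigma_finite_measure set (d.-tuple R) -> \bar R} :=
  match d with
  | 0 => \d_([tuple] : 0.-tuple R)
  | d'.+1 => lebesgue_step (borel_lebesgue R d')
  end.

(* [borel_lebesgue R d] is the d-fold product of the Lebesgue measure on R, on
   the product sigma-algebra; R^d is equipped below with its completion, i.e.
   with the sigma-algebra of Lebesgue (and not only Borel) measurable sets. *)
Definition Rd (R : realType) (d : nat) :=
  caratheodory_type (mu_ext (borel_lebesgue R d)).

Definition leb (R : realType) (d : nat) : {measure set (Rd R d) -> \bar R} :=
  @completed_measure_extension _ _ _ (borel_lebesgue R d).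

Section box.
Context {R : realType}.

Definition box d (a b : d.-tuple R) : set (d.-tuple R) :=
  [set y | forall i, tnth a i <= tnth y i <= tnth b i].

Lemma measurable_box d (a b : d.-tuple R) : measurable (box a b).
Proof.
have -> : box a b =
    \bigcap_(i in [set: 'I_d]) ((@tnth d R)^~ i @^-1` `[tnth a i, tnth b i]).
  apply/seteqP; split=> y /=.
  - by move=> yab i _ /=; rewrite in_itv/=; exact: yab.
  - by move=> yab i; have := yab i I; rewrite /= in_itv.
apply: fin_bigcap_measurable => //.
move=> i _; rewrite -[X in measurable X]setTI.
exact: measurable_tnth.
Qed.

Lemma borel_lebesgue_box d (a b : d.-tuple R) :
  (forall i, tnth a i <= tnth b i) ->
  borel_lebesgue R d (box a b) = (\prod_(i < d) (tnth b i - tnth a i))%:E.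
Proof.
elim: d a b => [|d IHd] a b ab.
  by rewrite big_ord0 /= diracE mem_set//; case.
rewrite big_ord_recl /= /lebesgue_step /pushforward.
set a' : d.-tuple R := [tuple of behead a].
set b' : d.-tuple R := [tuple of behead b].
have tb (z : d.+1.-tuple R) i : tnth [tuple of behead z] i = tnth z (lift ord0 i).
  by rewrite [in RHS](tuple_eta z) tnthS.
rewrite [X in product_measure1 _ _ X](_ : _ =
    (`[tnth a ord0, tnth b ord0] : set (measurableTypeR R)) `*` box a' b'); last first.
  apply/seteqP; split=> -[x y] /=.
  - move=> h; split; first by have := h ord0; rewrite in_itv.
    by move=> i; rewrite !tb; have := h (lift ord0 i); rewrite tnthS.
  - rewrite in_itv/= => -[h0 h] i.
    case: (unliftP ord0 i) => [j ->|->] //.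
    by rewrite tnthS -!tb; exact: h.
rewrite product_measure1E//; [|exact: measurable_box].
transitivity ((tnth b ord0 - tnth a ord0)%:E *
    (\prod_(i < d) (tnth b' i - tnth a' i))%:E)%E; last first.
  rewrite -EFinM; congr (_ * _)%:E.
  by apply: eq_bigr => i _; rewrite /a' /b' !tb.
congr (_ * _)%E; last by apply: IHd => i; rewrite /a' /b' !tb.
have := lebesgue_measure_itv `[tnth a ord0, tnth b ord0].
rewrite /= lte_fin lt_neqAle ab andbT => ->.
by case: eqVneq => [->|_] /=; rewrite ?subrr.
Qed.

Lemma leb_box d (a b : d.-tuple R) : (forall i, tnth a i <= tnth b i) ->
  leb R d (box a b) = (\prod_(i < d) (tnth b i - tnth a i))%:E.
Proof.
move=> ab; rewrite -borel_lebesgue_box//.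
exact: (measurable_mu_extE (borel_lebesgue R d) (measurable_box a b)).
Qed.

End box.

Section cubes_and_weights.
Context {R : realType} {d : nat}.
Implicit Types (Q : set (Rd R d)) (s : Rd R d -> R).
Local Notation mu := (leb R d).

Definition cube (a : Rd R d) (l : R) : set (Rd R d) :=
  [set y | forall i, tnth a i <= tnth y i <= tnth a i + l].

Definition is_cube (l : R) Q : Prop := 0 < l /\ exists a, Q = cube a l.

Definition cubes : set (set (Rd R d)) := [set Q | exists l, is_cube l Q].

(* sigma(E) *)
Definition wmass s (E : set (Rd R d)) : \bar R := (\int[mu]_(x in E) (s x)%:E)%E.

(* Every compact set lies in a cube, and the cubes are compact. *)
Definition locally_integrableRd s : Prop :=
  forall Q, cubes Q -> mu.-integrable Q (EFin \o s).

Definition weight s : Prop :=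
  [/\ measurable_fun setT s, locally_integrableRd s & {ae mu, forall x, 0 < s x}].

Definition doubling s : Prop :=
  exists2 C : R, 1 < C & forall (l l' : R) (Q Q' : set (Rd R d)),
    is_cube l Q -> is_cube l' Q' -> Q `<=` Q' -> l' <= 2 * l ->
    (wmass s Q' <= C%:E * wmass s Q)%E.

End cubes_and_weights.

Section growth_functions.
Context {R : realType}.
(* Functions on R_+ = [0, +oo[ are represented by total functions R -> R; only
   their values on [0, +oo[ are ever used. *)
Implicit Types (Phi Psi : R -> R) (q : R).

Definition Rplus : set R := `[0, +oo[.

Definition growth Phi : Prop :=
  [/\ set_fun Rplus Rplus Phi /\ set_surj Rplus Rplus Phi,
      exists2 t : R, 0 <= t & Phi t != 0,
      {within Rplus, continuous Phi}
    & forall s t : R, 0 <= s -> s <= t -> Phi s <= Phi t].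

Definition upper_type q Phi : Prop :=
  exists2 C : R, 0 < C &
    forall s t : R, 0 < s -> 1 <= t -> Phi (s * t) <= C * t `^ q * Phi s.

(* Every element of U is assumed to be convex and C^1, with Phi' ~ Phi(t)/t. *)
Definition normalised Phi : Prop :=
  [/\ convex_function Rplus Phi,
      forall t : R, 0 < t -> derivable Phi t 1,
      forall t : R, 0 < t -> {for t, continuous (derive1 Phi)}
    & exists2 c : R, 0 < c & forall t : R, 0 < t ->
        c^-1 * (Phi t / t) <= derive1 Phi t <= c * (Phi t / t)].

Definition classUq q Phi : Prop :=
  [/\ growth Phi, upper_type q Phi,
      forall s t : R, 0 < s -> s <= t -> Phi s / s <= Phi t / t
    & normalised Phi].

Definition classU Phi : Prop := exists2 q : R, 1 <= q & classUq q Phi.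

Definition Delta' Phi : Prop :=
  exists2 C : R, 0 < C &
    forall s t : R, 0 < s -> 0 < t -> Phi (s * t) <= C * Phi s * Phi t.

Definition Delta2 Phi : Prop :=
  exists2 K : R, 0 < K & forall t : R, 0 < t -> Phi (2 * t) <= K * Phi t.

Definition nabla2 Phi : Prop :=
  [/\ growth Phi, convex_function Rplus Phi, Delta2 Phi
    & exists2 C : R, 0 < C & forall t : R, 0 < t ->
        (\int[lebesgue_measure]_(s in `]0%R, t]) (Phi s / s ^+ 2)%:E
           <= (C * (Phi t / t))%:E)%E].

Definition classUtilde_q q Psi : Prop :=
  [/\ classUq q Psi, Delta' Psi
    & exists2 C : R, 0 < C &
        forall s t : R, 1 <= s -> 1 <= t -> Psi (s / t) <= C * Psi s / t `^ q].

Definition classUtilde Psi : Prop := exists2 q : R, 1 <= q & classUtilde_q q Psi.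

(* Phi^-1 : R_+ -> R_+ *)
Definition ginv Phi : R -> R := pinv Rplus Phi.

(* The extension to [0, +oo] by the value +oo at +oo; needed since maximal
   functions, norms and suprema take values in [0, +oo]. *)
Definition ext Phi (x : \bar R) : \bar R :=
  match x with
  | r%:E => (Phi r)%:E
  | +oo%E => +oo%E
  | -oo%E => 0%E
  end.

End growth_functions.

Section Orlicz.
Context {R : realType} {d : nat}.
Local Notation mu := (leb R d).
Local Open Scope ereal_scope.

Definition measurableC (f : Rd R d -> R[i]) : Prop :=
  measurable_fun setT (fun x => complex.Re (f x)) /\
  measurable_fun setT (fun x => complex.Im (f x)).

Definition modulus (f : Rd R d -> R[i]) (x : Rd R d) : R :=
  ComplexField.Normc.normc (f x).

(* The Luxemburg norm of a function with modulus g, for the weight s *)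
Definition lux (Phi : R -> R) (s : Rd R d -> R) (g : Rd R d -> \bar R) : \bar R :=
  ereal_inf [set l%:E | l in [set l : R | (0 < l)%R /\
    \int[mu]_x (ext Phi (g x / l%:E) * (s x)%:E) <= 1]].

Definition luxC (Phi : R -> R) (s : Rd R d -> R) (f : Rd R d -> R[i]) : \bar R :=
  lux Phi s (EFin \o modulus f).

Definition LPhi (Phi : R -> R) (s : Rd R d -> R) : set (Rd R d -> R[i]) :=
  [set f | measurableC f /\ luxC Phi s f < +oo].

Section multilinear.
Context {n : nat}.
Implicit Types (s : 'I_n -> Rd R d -> R) (f : 'I_n -> Rd R d -> R[i]).

Definition maximal s f (x : Rd R d) : \bar R :=
  ereal_sup [set \prod_(i < n)
    ((\1_Q x)%:E / wmass (s i) Q *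
     \int[mu]_(y in Q) (modulus (f i) y * s i y)%:E) | Q in cubes].

Section operators.
Variables (T : ('I_n -> Rd R d -> R[i]) -> Rd R d -> \bar R).
Variables (Phis : 'I_n -> R -> R) (s : 'I_n -> Rd R d -> R).
Variables (Psi : R -> R) (w : Rd R d -> R).

(* T takes values in [0, +oo]: T f is in L^Psi(w) iff the left-hand side of the
   inequality is finite. *)
Definition bound_const (C : R) : Prop :=
  (0 < C)%R /\ forall f, (forall i, LPhi (Phis i) (s i) (f i)) ->
    lux Psi w (T f) <= C%:E * \prod_(i < n) luxC (Phis i) (s i) (f i).

Definition bounded_op : Prop := exists C, bound_const C.

(* +oo when T is not bounded *)
Definition opnorm : \bar R := ereal_inf [set C%:E | C in bound_const].

End operators.

Definition nu (Phi : R -> R) (Phis : 'I_n -> R -> R) s (x : Rd R d) : R :=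
  ((Phi (\prod_(i < n) ginv (Phis i) (s i x)^-1))^-1)%R.

(* [sigma, omega]_{M_{Phi, Psi}} *)
Definition Mconst (Phi : R -> R) (Phis : 'I_n -> R -> R) (Psi : R -> R)
    s (w : Rd R d -> R) : \bar R :=
  ereal_sup [set wmass w Q *
    ext Psi (ext (ginv Phi) (wmass (nu Phi Phis s) Q)^-1) | Q in cubes].

End multilinear.
End Orlicz.

(* Main.v *)
Require Import Defs.
From mathcomp Require Import all_boot all_order all_algebra.
From mathcomp Require Import all_classical all_reals all_analysis.
From mathcomp Require Import measurable_realfun zify complex ring lra.
Set Implicit Arguments.
Unset Strict Implicit.
Unset Printing Implicit Defensive.
Import Order.TTheory GRing.Theory Num.Theory.
Import numFieldNormedType.Exports.
Local Open Scope classical_set_scope.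
Local Open Scope ring_scope.

(** Necessity is a test on [f_i = Phi_i^-1 (1 / sigma Q) 1_Q], whose modulars are
    [1] and whose maximal function is at least [Phi^-1 (1 / sigma Q)] on [Q]; the
    submultiplicativity of [Psi] does the rest ([bounded_Mconst]).

    For sufficiency, fix [f_i] of small modular and a geometric sequence [u_k],
    [k] in Z, and compare level sets at the heights [lam_k = Phi^-1 u_k] and
    [t_ik = Phi_i^-1 u_k]. Since [lam_k] is the product of the [t_ik], the set
    [{M f > lam_k}] is contained in the union of the sets [{M_i f_i > t_ik}] of the
    one-function maximal operators. For the latter a weak-type inequality
    ([weak_type]) follows from the Vitali covering argument and doubling. Condition
    [nabla_2] makes [Phi_i t / t] grow geometrically along [t_ik]
    ([nabla2_doubling]), so that summing over [k] yields a modular inequality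
    ([modular_superlevel]), and sum_k [u_k sigma (M f > lam_k)] is small
    ([modular_product_superlevel]).

    The weight [omega] enters only here. If a cube [Q] has a product of averages
    above [lam_k], then [Q] is contained in the level set, hence
    [u_k <= 1 / sigma(3Q)] by the smallness just obtained. As [Psi / Phi] increases,
    [Psi(lam_k) / u_k <= Psi(b) sigma(3Q)] with [b = Phi^-1 (1 / sigma(3Q))], and the
    hypothesis [omega(3Q) Psi(b) <= A] becomes
    [Psi(lam_k) omega(3Q) <= A u_k sigma(3Q)]. A second covering argument gives
    [Psi(lam_k) omega(M f > lam_k) <= A D u_k sigma(M f > lam_k)], where [D] is the
    doubling constant of the passage from [Q] to [3Q]
    ([omega_product_superlevel]), and summing over [k] bounds the integral of
    [Psi(M f) omega] by a multiple of [A]. The condition defining [Utilde] says that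
    [Psi t Psi(1/t)] is bounded ([classUtilde_inv]), which converts this modular
    bound into the norm bound [Psi^-1 A].

    Level sets are taken over a countable family of cubes, which makes them
    measurable; by doubling every cube is contained in a comparable one of the
    family. The maximal function itself is only ever estimated from above and below
    by measurable functions ([ge0_le_integral_off_null]). *)

(** * Growth functions *)

Lemma eq_leW disp (T : porderType disp) (x y : T) : x = y -> (x <= y)%O.
Proof. by move=> ->. Qed.

Section growth_function_theory.
Context {R : realType}.
Implicit Types (Phi Psi : R -> R) (s t y : R).

Lemma RplusE t : Rplus t = (0 <= t).
Proof. by rewrite /Rplus /= in_itv/= andbT. Qed.

Lemma mem_Rplus t : (t \in (@Rplus R)) = (0 <= t).
Proof. by apply/idP/idP; rewrite inE RplusE. Qed.

Section growth.
Variable Phi : R -> R.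
Hypothesis gPhi : growth Phi.

Lemma growth_ge0 t : 0 <= t -> 0 <= Phi t.
Proof. by case: gPhi => -[fPhi _] _ _ _ t0; have := fPhi t; rewrite !RplusE; apply. Qed.

Lemma growth_le s t : 0 <= s -> s <= t -> Phi s <= Phi t.
Proof. by case: gPhi => _ _ _; exact. Qed.

Lemma growth_surj y : 0 <= y -> exists2 t, 0 <= t & Phi t = y.
Proof.
case: gPhi => -[_ sPhi] _ _ _ y0; have := sPhi y; rewrite RplusE => /(_ y0)[t].
by rewrite RplusE => t0 <-; exists t.
Qed.

Lemma growth0 : Phi 0 = 0.
Proof.
have [t t0 Phit] := growth_surj (lexx 0).
have := growth_le (lexx 0) t0; rewrite Phit => P0.
by apply/eqP; rewrite eq_le P0 growth_ge0.
Qed.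

Lemma ginvK y : 0 <= y -> Phi (ginv Phi y) = y.
Proof.
case: gPhi => -[_ sPhi] _ _ _ y0; apply: (surjpK _ sPhi).
by rewrite mem_Rplus.
Qed.

Lemma ginv_ge0 y : 0 <= y -> 0 <= ginv Phi y.
Proof.
case: gPhi => -[_ sPhi] _ _ _ y0; rewrite -RplusE.
by apply: (surjpinv_image_sub sPhi); exists y => //; rewrite RplusE.
Qed.

End growth.

Section classU.
Variable Phi : R -> R.
Hypothesis UPhi : classU Phi.

Lemma classU_growth : growth Phi.
Proof. by case: UPhi => q _ []. Qed.
Let gPhi := classU_growth.

Lemma classU_ratio s t : 0 < s -> s <= t -> Phi s / s <= Phi t / t.
Proof. by case: UPhi => q _ [_ _ + _]; exact. Qed.

(** Were [Phi] to vanish at some [s > 0], upper-type growth would propagate the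
    zero to [s, +oo[ and [Phi] could not be onto. *)
Lemma classU_gt0 t : 0 < t -> 0 < Phi t.
Proof.
move=> t0; rewrite lt_neqAle eq_sym (growth_ge0 gPhi (ltW t0)) andbT.
apply/eqP => Phit; have [s s0 Phis] := growth_surj gPhi (ler01 : 0 <= 1 :> R).
have [q _ [_ [C C0 Ct] _ _]] := UPhi.
suff : Phi s <= 0 by rewrite Phis ler10.
have [st|ts] := leP s t; first by rewrite -Phit (growth_le gPhi).
have := Ct t (s / t) t0; rewrite ler_pdivlMr// mul1r (ltW ts) => /(_ isT).
by rewrite mulrCA divff ?gt_eqF// mulr1 Phit mulr0.
Qed.

Lemma classU_lt s t : 0 <= s -> s < t -> Phi s < Phi t.
Proof.
move=> s0 st; have t0 := le_lt_trans s0 st.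
move: s0; rewrite le_eqVlt => /predU1P[<-|s0].
  by rewrite (growth0 gPhi) classU_gt0.
have := classU_ratio s0 (ltW st).
rewrite ler_pdivrMr// => /le_lt_trans; apply.
by rewrite -mulrA gtr_pMr ?classU_gt0// ltr_pdivrMl// mulr1.
Qed.

Lemma classU_leW s t : 0 <= s -> 0 <= t -> Phi s <= Phi t -> s <= t.
Proof. by move=> s0 t0; apply: contraTT; rewrite -!ltNge => /(classU_lt t0). Qed.

Lemma ginvVK t : 0 <= t -> ginv Phi (Phi t) = t.
Proof.
move=> t0; have h := ginvK gPhi (growth_ge0 gPhi t0).
have g0 := ginv_ge0 gPhi (growth_ge0 gPhi t0).
by apply/le_anti/andP; split; apply: classU_leW; rewrite // h.
Qed.

Lemma ginv_le s t : 0 <= s -> s <= t -> ginv Phi s <= ginv Phi t.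
Proof.
move=> s0 st; have t0 := le_trans s0 st.
apply: classU_leW; [exact: ginv_ge0|exact: ginv_ge0|].
by rewrite !ginvK.
Qed.

Lemma ginv_lt s t : 0 <= s -> s < t -> ginv Phi s < ginv Phi t.
Proof.
move=> s0 st; have t0 := le_trans s0 (ltW st).
rewrite ltNge; apply/negP => /(growth_le gPhi (ginv_ge0 gPhi t0)).
by rewrite !ginvK// leNgt st.
Qed.

Lemma ginv0 : ginv Phi 0 = 0.
Proof. by rewrite -[in LHS](growth0 gPhi) ginvVK. Qed.

Lemma ginv_gt0 t : 0 < t -> 0 < ginv Phi t.
Proof. by move=> t0; rewrite -ginv0 ginv_lt. Qed.

Lemma classU_scale c t : 1 <= c -> 0 <= t -> c * Phi t <= Phi (c * t).
Proof.
move=> c1; rewrite le_eqVlt => /predU1P[<-|t0].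
  by rewrite mulr0 (growth0 gPhi) mulr0.
have c0 : 0 < c by exact: lt_le_trans c1.
have := @classU_ratio t (c * t) t0; rewrite ler_peMl ?(ltW t0)// => /(_ isT).
rewrite ler_pdivlMr ?mulr_gt0//; apply: le_trans.
by rewrite mulrCA divfK ?gt_eqF.
Qed.

Lemma classU_scaleV c t : 1 <= c -> 0 <= t -> Phi (t / c) <= Phi t / c.
Proof.
move=> c1 t0; have c0 : 0 < c by exact: lt_le_trans c1.
rewrite ler_pdivlMr// mulrC (le_trans (classU_scale _ _))// ?divr_ge0 ?(ltW c0)//.
by rewrite mulrCA divff ?gt_eqF// mulr1.
Qed.

Lemma ginv_scale c y : 1 <= c -> 0 <= y -> ginv Phi (c * y) <= c * ginv Phi y.
Proof.
move=> c1 y0; have c0 : 0 <= c by exact: le_trans c1.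
have cy0 : 0 <= c * y by rewrite mulr_ge0.
have g0 := ginv_ge0 gPhi y0.
apply: classU_leW; [exact: ginv_ge0|by rewrite mulr_ge0|].
by rewrite ginvK// -{1}(ginvK gPhi y0) classU_scale.
Qed.

Lemma classU_upper c : 1 <= c ->
  exists2 K, 1 <= K & forall t, 0 <= t -> Phi (c * t) <= K * Phi t.
Proof.
move=> c1; have [q _ [_ [C C0 Ct] _ _]] := UPhi.
have K0 : 0 <= C * c `^ q by rewrite mulr_ge0 ?powR_ge0 ?ltW.
exists (1 + C * c `^ q); first by rewrite lerDl.
move=> t; rewrite le_eqVlt => /predU1P[<-|t0].
  by rewrite mulr0 (growth0 gPhi) mulr0.
rewrite mulrC (le_trans (Ct _ _ t0 c1))//.
by rewrite mulrDl mul1r lerDr growth_ge0 ?ltW.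
Qed.

End classU.

(** The [Utilde] condition and upper-type growth pin down [Psi] near [0] by its
    behaviour at infinity. *)
Lemma classUtilde_inv Psi : classUtilde Psi ->
  exists2 K, 0 < K & forall t, 0 < t -> Psi t * Psi t^-1 <= K.
Proof.
move=> [q q1 [Uq _ [C C0 Ct]]]; have UPsi : classU Psi by exists q.
have [gPsi [C' C'0 Ct'] _ _] := Uq.
have P1 := classU_gt0 UPsi ltr01.
have main t : 1 <= t -> Psi t * Psi t^-1 <= C * C' * Psi 1 ^+ 2.
  move=> t1; have t0 : 0 < t by exact: lt_le_trans t1.
  have h1 := Ct 1 t (lexx _) t1; rewrite div1r in h1.
  have h2 := Ct' 1 t ltr01 t1; rewrite mul1r in h2.
  have tq : 0 < t `^ q by rewrite powR_gt0.
  apply: (@le_trans _ _ ((C' * t `^ q * Psi 1) * (C * Psi 1 / t `^ q))).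
    by apply: ler_pM => //; rewrite growth_ge0 ?invr_ge0 ?ltW.
  by apply/eq_leW; field; rewrite gt_eqF.
exists (C * C' * Psi 1 ^+ 2); first by rewrite !mulr_gt0 ?exprn_gt0.
move=> t t0; have [t1|t1] := leP 1 t; first exact: main.
by rewrite mulrC -{2}(invrK t) main// invf_ge1// ltW.
Qed.

Lemma Delta'_bound Psi : classU Psi -> Delta' Psi ->
  exists2 K, 1 <= K & forall s t, 0 <= s -> 0 < t -> Psi (s * t) <= K * Psi s * Psi t.
Proof.
move=> UPsi [C C0 Ct]; have gPsi := classU_growth UPsi.
exists (1 + C); first by rewrite lerDl ltW.
move=> s t; rewrite le_eqVlt => /predU1P[<-|s0] t0.
  by rewrite mul0r (growth0 gPsi) mulr0 mul0r.
rewrite (le_trans (Ct _ _ s0 t0))// -!mulrA ler_wpM2r ?lerDr//.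
by rewrite mulr_ge0 ?growth_ge0 ?ltW.
Qed.

Lemma growth_ext_le Phi : growth Phi ->
  forall (a b : \bar R), (0 <= a)%E -> (a <= b)%E -> (ext Phi a <= ext Phi b)%E.
Proof.
move=> gPhi [a| |] [b| |]//=; rewrite ?lee_fin ?leey// => a0 ab.
exact: (growth_le gPhi).
Qed.

Lemma ext_ge0 Phi : growth Phi -> forall a : \bar R, (0 <= a)%E -> (0 <= ext Phi a)%E.
Proof. by move=> gPhi [a| |]//=; rewrite ?lee_fin ?leey//; exact: growth_ge0. Qed.

End growth_function_theory.

(** * Geometric sums over the integers and the condition nabla_2 *)

Section geometric_sums.
Context {R : realType}.
Local Open Scope ereal_scope.

(** Pairing [k] with [- k - 1] turns a sum over Z into a series of nonnegative terms
    over [nat], which can be exchanged with integrals. *)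
Definition zsum (T : int -> \bar R) : \bar R :=
  \sum_(j <oo) (T (Posz j) + T (Negz j)).

Lemma zsum_partial (T : int -> \bar R) (m : nat) :
  \sum_(0 <= j < m) (T (Posz j) + T (Negz j)) =
  \sum_(k < m + m) T (Posz k - Posz m)%R.
Proof.
rewrite big_split_ord/= big_mkord big_split/= addeC; congr (_ + _).
  rewrite (reindex_inj rev_ord_inj)/=; apply: eq_bigr => i _; congr T.
  by rewrite NegzE; have := ltn_ord i; lia.
by apply: eq_bigr => i _; congr T; lia.
Qed.

Lemma zsum_le (T : int -> \bar R) (X : \bar R) : (forall k, 0 <= T k) ->
  (forall m, \sum_(k < m + m) T (Posz k - Posz m)%R <= X) -> zsum T <= X.
Proof.
move=> T0 TX; apply: lime_le; first by apply: is_cvg_nneseries => n _ _; rewrite adde_ge0.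
by apply: nearW => m; rewrite zsum_partial.
Qed.

Lemma zsum_ge (T : int -> \bar R) k : (forall k, 0 <= T k) -> T k <= zsum T.
Proof.
move=> T0; case: k => j.
- apply: (@le_trans _ _ (T (Posz j) + T (Negz j))); first by rewrite leeDl.
  rewrite /zsum (nneseriesD1 (n := j) (P := xpredT))//; last by move=> i _; rewrite adde_ge0.
  by rewrite leeDl// nneseries_ge0// => i _ _; rewrite adde_ge0.
- apply: (@le_trans _ _ (T (Posz j) + T (Negz j))); first by rewrite leeDr.
  rewrite /zsum (nneseriesD1 (n := j) (P := xpredT))//; last by move=> i _; rewrite adde_ge0.
  by rewrite leeDl// nneseries_ge0// => i _ _; rewrite adde_ge0.
Qed.

Lemma le_zsum (S T : int -> \bar R) : (forall k, 0 <= S k) ->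
  (forall k, S k <= T k) -> zsum S <= zsum T.
Proof.
move=> S0 ST; apply: lee_nneseries => [i _ _|i _]; first by rewrite adde_ge0.
by rewrite leeD.
Qed.

Lemma zsumZ (c : R) (T : int -> \bar R) : (forall k, 0 <= T k) ->
  (0 <= c)%R -> zsum (fun k => c%:E * T k) = c%:E * zsum T.
Proof.
move=> T0 c0; rewrite /zsum -nneseriesZl// => [|i _]; last by rewrite adde_ge0.
by apply: eq_eseriesr => i _; rewrite ge0_muleDr.
Qed.

Lemma zsum_sum n (T : 'I_n -> int -> \bar R) : (forall i k, 0 <= T i k) ->
  zsum (fun k => \sum_(i < n) T i k) = \sum_(i < n) zsum (T i).
Proof.
move=> T0; rewrite /zsum -nneseries_sum// => [|i j _]; last by rewrite adde_ge0.
by apply: eq_eseriesr => j _; rewrite big_split.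
Qed.

Lemma geometric_partial (a : nat -> R) (c : pred nat) (X : R) :
  (0 <= X)%R -> (forall k, 0 <= a k)%R -> (forall k, 2 * a k <= a k.+1)%R ->
  (forall k, c k -> a k <= X)%R ->
  forall m, (\sum_(k < m) (if c k then a k else 0) <= 2 * X)%R.
Proof.
move=> X0 a0 a2 cX; have full m : (\sum_(k < m.+1) a k <= 2 * a m)%R.
  elim: m => [|m IH]; first by rewrite big_ord1; have := a0 0%N; lra.
  by rewrite big_ord_recr/=; have := a2 m; have := a0 m; lra.
elim=> [|m IH]; first by rewrite big_ord0 mulr_ge0.
case: (boolP (c m)) => cm; last by rewrite big_ord_recr/= (negbTE cm) addr0.
apply: (@le_trans _ _ (2 * a m)%R); last by rewrite ler_pM2l// cX.
by apply: le_trans (full m); apply: ler_sum => i _; case: ifP.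
Qed.

(** The terms at least double at each step, so that the largest selected term
    dominates the sum of all the others. *)
Lemma zsum_geometric (a : int -> R) (c : pred int) (X : R) :
  (0 <= X)%R -> (forall k, 0 <= a k)%R -> (forall k, 2 * a k <= a (k + 1))%R ->
  (forall k, c k -> a k <= X)%R ->
  zsum (fun k => (if c k then a k else 0)%:E) <= (2 * X)%:E.
Proof.
move=> X0 a0 a2 cX; apply: zsum_le => [k|m].
  by rewrite lee_fin; case: ifP.
rewrite sumEFin lee_fin.
apply: (@geometric_partial (fun k => a (Posz k - Posz m)%R)
  (fun k => c (Posz k - Posz m)%R)) => // [k|k]; last exact: cX.
by rewrite (le_trans (a2 _))//; apply/eq_leW; congr a; lia.
Qed.

End geometric_sums.

Section levels.
Context {R : realType}.

Definition level (L : R) (k : int) : R := expR (L * k%:~R).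

Lemma level_gt0 L k : 0 < level L k. Proof. exact: expR_gt0. Qed.

Lemma levelS L k : level L (k + 1) = expR L * level L k.
Proof. by rewrite /level -expRD; congr expR; rewrite intrD; ring. Qed.

Lemma level_between L w : 0 < L -> 0 < w ->
  exists k, level L k < w <= level L (k + 1).
Proof.
move=> L0 w0; pose k := Num.ceil (ln w / L) - 1.
exists k; rewrite -{1 2}(lnK w0) ltr_expR ler_expR.
rewrite mulrC -ltr_pdivlMr// [(L * _)]mulrC -ler_pdivrMr// subrK.
exact: ceil_itv.
Qed.

End levels.

Section nabla2.
Context {R : realType}.
Variable Phi : R -> R.
Hypotheses (UPhi : classU Phi) (nPhi : nabla2 Phi).
Let gPhi := classU_growth UPhi.
Notation phi := (fun t => Phi t / t).


Let meas_integrand (D : set R) : measurable D -> D `<=` `]0, +oo[ ->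
  measurable_fun D (EFin \o (fun s : R => Phi s / s ^+ 2)).
Proof.
move=> mD D0; apply/measurable_EFinP.
suff mpos : measurable_fun (`]0, +oo[%classic : set R) (fun s : R => Phi s / s ^+ 2).
  by apply: measurable_funS mpos.
apply: open_continuous_measurable_fun => // t; rewrite inE/= in_itv/= andbT => t0.
have [q _ [_ _ _ [_ dPhi _ _]]] := UPhi.
apply: cvgM.
  by apply/differentiable_continuous/derivable1_diffP/dPhi.
by apply: cvgV; [rewrite expf_neq0// gt_eqF|exact: exprn_continuous].
Qed.

Let int_step t : 0 < t ->
  (\int[lebesgue_measure]_(s in `]0%R, (t / 2)%R]) (Phi s / s ^+ 2)%:E
   + (phi (t / 2) / 4)%:E <=
   \int[lebesgue_measure]_(s in `]0%R, t]) (Phi s / s ^+ 2)%:E)%E.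
Proof.
move=> t0; have t20 : 0 < t / 2 by rewrite divr_gt0.
have tt : t / 2 < t by rewrite ltr_pdivrMr// ltr_pMr// ltr1n.
have sub D : D `<=` `]0, t] -> D `<=` `]0, +oo[.
  by move=> Dt x /Dt/=; rewrite !in_itv/= => /andP[->].
have f0 x : x \in `]0, t] -> (0 <= (Phi x / x ^+ 2)%:E)%E.
  rewrite in_itv/= => /andP[x0 _].
  by rewrite lee_fin divr_ge0 ?exprn_ge0 ?(growth_ge0 gPhi) ?ltW.
have -> : (`]0, t] = `]0, t / 2] `|` `]t / 2, t])%classic.
  by apply: itv_bndbnd_setU; rewrite bnd_simp ltW.
have s1 : `]0, t / 2] `<=` `]0, t].
  by move=> x /=; rewrite !in_itv/= => /andP[-> /le_trans->]//; rewrite ltW.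
have s2 : `]t / 2, t] `<=` `]0, t].
  by move=> x /=; rewrite !in_itv/= => /andP[/(lt_trans t20)-> ->].
rewrite ge0_integral_setU//=; last 3 first.
- apply: meas_integrand; first by apply: measurableU; exact: measurable_itv.
  by apply: sub => x [xA|xB]; [exact: s1|exact: s2].
- by move=> x [xA|xB]; apply: f0; [exact: s1|exact: s2].
- rewrite disj_set2E; apply/eqP/seteqP; split => // x [] /=.
  by rewrite !in_itv/= => /andP[_ /le_lt_trans h] /andP[/h]; rewrite ltxx.
apply: leeD2l.
apply: (@le_trans _ _ (\int[lebesgue_measure]_(s in `](t / 2)%R, t])
    (cst (Phi (t / 2) / t ^+ 2)%:E s))%E).
  rewrite integral_cst//= lebesgue_measure_itv/= lte_fin tt -EFinD -EFinM lee_fin.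
  by apply/eq_leW; field; rewrite gt_eqF.
apply: ge0_le_integral => //.
- by move=> x _; rewrite lee_fin divr_ge0 ?exprn_ge0 ?(growth_ge0 gPhi) ?ltW.
- by apply: meas_integrand => //; exact: sub.
move=> x /=; rewrite in_itv/= lee_fin => /andP[tx xt].
have x0 := lt_trans t20 tx.
apply: ler_pM.
- exact/(growth_ge0 gPhi)/ltW.
- by rewrite invr_ge0 exprn_ge0// ltW.
- by apply: (growth_le gPhi); exact: ltW.
rewrite lef_pV2 ?posrE ?exprn_gt0//.
by apply: lerXn2r => //; rewrite nnegrE ltW.
Qed.

(** As [Phi t / t] is nondecreasing, each of the intervals [t / 2 ^ (j + 1), t / 2 ^ j]
    contributes at least [phi (t / 2 ^ m) / 4] to the integral in the [nabla_2]
    condition, for [j < m]; hence [m * phi (t / 2 ^ m) <= 4 C phi t] for every [m]. *)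
Lemma nabla2_doubling : exists2 N, 1 <= N &
  forall t, 0 < t -> 2 * phi t <= phi (N * t).
Proof.
have [_ _ _ [C C0 HC]] := nPhi.
have low m t : 0 < t -> ((m%:R * (phi (t / 2 ^+ m) / 4))%:E <=
   \int[lebesgue_measure]_(s in `]0%R, t]) (Phi s / s ^+ 2)%:E)%E.
  elim: m t => [|m IH] t t0.
    rewrite mul0r; apply: integral_ge0 => x /=; rewrite in_itv/= => /andP[x0 _].
    by rewrite lee_fin divr_ge0 ?exprn_ge0 ?(growth_ge0 gPhi) ?ltW.
  have t20 : 0 < t / 2 by rewrite divr_gt0.
  apply: le_trans (int_step t0); apply: le_trans (leeD2r _ (IH _ t20)).
  rewrite -EFinD lee_fin mulrSr mulrDl mul1r.
  have -> : t / 2 / 2 ^+ m = t / 2 ^+ m.+1 by rewrite exprS invfM mulrA.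
  rewrite lerD2l ler_pM2r ?invr_gt0//.
  apply: classU_ratio => //; first by rewrite divr_gt0 ?exprn_gt0.
  rewrite ler_pM2l// lef_pV2 ?posrE ?exprn_gt0//.
  by rewrite exprS ler_peMr// exprn_ege1// ler1n.
pose m := (Num.truncn (8 * C)).+1.
exists (2 ^+ m); first by rewrite exprn_ege1// ler1n.
move=> t t0; have m0 : 0 < (2 : R) ^+ m by rewrite exprn_gt0.
have Nt : 0 < 2 ^+ m * t by rewrite mulr_gt0.
have := le_trans (low m _ Nt) (HC _ Nt).
rewrite lee_fin [2 ^+ m * t / _]mulrAC divff ?gt_eqF// mul1r => h.
have m8 : 8 * C <= m%:R by rewrite ltW// truncnS_gt.
have p0 : 0 < phi t by rewrite divr_gt0// classU_gt0.
rewrite -(ler_pM2l C0); apply: le_trans h.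
by have := ler_wpM2r (ltW p0) m8; lra.
Qed.

End nabla2.

(** * Integrals, null sets and cubes *)

Section integrals_without_measurability.
Context d (T : measurableType d) (R : realType).
Variable mu : {measure set T -> \bar R}.
Local Open Scope ereal_scope.

Import HBNNSimple.

(** Maximal functions are suprema of uncountable families: the comparison below
    holds for arbitrary functions because the integral of a nonnegative function
    is the supremum of the integrals of the simple functions below it, and each
    of these is measurable. *)
Lemma ge0_le_integral_off_null (N : set T) (f g : T -> \bar R) :
  measurable N -> mu N = 0 -> (forall x, 0 <= f x) -> (forall x, 0 <= g x) ->
  (forall x, ~ N x -> f x <= g x) -> \int[mu]_x f x <= \int[mu]_x g x.
Proof.
move=> mN N0 f0 g0 fg; rewrite [leLHS]ge0_integralTE//.
apply: ge_ereal_sup => _ [h /= hf <-].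
rewrite -integralT_nnsfun.
have mh D : measurable_fun D (fun x => (h x)%:E).
  by apply/measurable_EFinP; apply: measurable_funTS.
rewrite (ge0_negligible_integral mN)//; last by move=> x _; rewrite lee_fin.
rewrite integral_mkcond [leRHS]ge0_integralTE//.
(* [k] vanishes on [N], where nothing is known about [f] and [g]. *)
pose k := mul_nnsfun h (indic_nnsfun R (measurableC mN)).
have -> : (fun x => (h x)%:E) \_ (setT `\` N) = EFin \o k.
  apply/funext => x; rewrite patchE /= setTD.
  by rewrite /k /= mindicE; case: ifPn => _; rewrite ?mulr1 ?mulr0.
rewrite [leLHS](integralT_nnsfun mu k); apply: ereal_sup_ubound; exists k => //= x.
rewrite mindicE; have [xN|xN] := boolP (x \in ~` N).
  rewrite mulr1; apply: (le_trans (hf x)); apply: fg.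
  by move: xN; rewrite inE.
by rewrite mulr0.
Qed.

Lemma integral_off_null (N D : set T) (f g : T -> \bar R) :
  measurable N -> mu N = 0 -> (forall x, ~ N x -> f x = g x) ->
  \int[mu]_(x in D) f x = \int[mu]_(x in D) g x.
Proof.
move=> mN N0 fg; rewrite integralE [RHS]integralE.
have pos (u v : T -> \bar R) : (forall x, 0 <= u x) -> (forall x, 0 <= v x) ->
    (forall x, ~ N x -> u x = v x) -> \int[mu]_(x in D) u x = \int[mu]_(x in D) v x.
  move=> u0 v0 uv; rewrite integral_mkcond [RHS]integral_mkcond.
  by apply/le_anti/andP; split; apply: (ge0_le_integral_off_null mN N0);
    rewrite /patch => x; case: ifP => // _ /uv ->.
congr (_ - _); apply: pos => // x /fg; rewrite ?funeposE ?funenegE => -> //.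
Qed.

Lemma ge0_le_integralT (f g : T -> \bar R) : (forall x, 0 <= f x) ->
  (forall x, f x <= g x) -> \int[mu]_x f x <= \int[mu]_x g x.
Proof.
move=> f0 fg; apply: (@ge0_le_integral_off_null set0) => // x.
exact: le_trans (fg x).
Qed.

End integrals_without_measurability.

Section cubes.
Context {R : realType} {d : nat}.
Local Notation mu := (leb R d).
Implicit Types (a : Rd R d) (l : R).

Definition shift_corner a l : Rd R d := [tuple tnth a i - l | i < d].

Definition triple a l : set (Rd R d) := cube (shift_corner a l) (3 * l).

Lemma measurable_cube a l : measurable (cube a l : set (Rd R d)).
Proof.
pose b : d.-tuple R := [tuple tnth a i + l | i < d].
rewrite (_ : cube a l = box a b).
  by apply: sub_caratheodory; apply: sub_sigma_algebra; exact: measurable_box.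
by apply/seteqP; split => x /= h i; have := h i; rewrite tnth_mktuple.
Qed.

Lemma measurable_cubes (Q : set (Rd R d)) : cubes Q -> measurable Q.
Proof. by move=> [l [_ [a ->]]]; exact: measurable_cube. Qed.

Lemma leb_cube a l : 0 <= l -> mu (cube a l) = (l ^+ d)%:E.
Proof.
move=> l0; pose b : d.-tuple R := [tuple tnth a i + l | i < d].
rewrite (_ : cube a l = box a b); last first.
  by apply/seteqP; split => x /= h i; have := h i; rewrite tnth_mktuple.
rewrite (@leb_box _ _ a b) => [|i]; last by rewrite tnth_mktuple lerDl.
congr EFin; rewrite (eq_bigr (fun=> l)) ?prodr_const ?card_ord// => i _.
by rewrite tnth_mktuple addrC addKr.
Qed.

Lemma corner_in_cube a l : 0 <= l -> cube a l a.
Proof. by move=> l0 i; rewrite lexx lerDl. Qed.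

Lemma is_cube_cube a l : 0 < l -> is_cube l (cube a l).
Proof. by move=> l0; split => //; exists a. Qed.

Lemma cubes_cube a l : 0 < l -> cubes (cube a l).
Proof. by move=> l0; exists l; exact: is_cube_cube. Qed.

Lemma cubes_triple a l : 0 < l -> cubes (triple a l).
Proof. by move=> l0; apply: cubes_cube; rewrite mulr_gt0. Qed.

Lemma sub_triple a b l r : r <= l -> cube a l `&` cube b r !=set0 ->
  cube b r `<=` triple a l.
Proof.
move=> rl [z [za zb]] y yb i; have := za i; have := zb i; have := yb i.
by rewrite tnth_mktuple; lra.
Qed.

(** Finite Vitali selection: a largest cube is kept, the cubes that meet it are
    contained in its triple and are discarded, and so on. *)
Lemma vitali_cubes (I : eqType) (a : I -> Rd R d) (l : I -> R) (s : seq I) :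
  (forall i, i \in s -> 0 < l i) ->
  exists s', [/\ uniq s', {subset s' <= s},
    trivIset [set` s'] (fun i => cube (a i) (l i)) &
    forall i, i \in s -> exists2 j, j \in s' & cube (a i) (l i) `<=` triple (a j) (l j)].
Proof.
have [m sm] := ubnP (size s); elim: m => // m IH in s sm *; move=> l0.
have [->|sn] := eqVneq s [::]; first by exists [::]; split => //= x; rewrite inE.
have [j js jmax] : exists2 j, j \in s & forall i, i \in s -> l i <= l j.
  clear -sn; elim: s sn => // x s IH _; have [->|sn] := eqVneq s [::].
    by exists x; rewrite ?mem_head// => i; rewrite inE => /eqP ->.
  have [j js jmax] := IH sn; have [jx|xj] := leP (l j) (l x).
    exists x; rewrite ?mem_head// => i; rewrite inE => /predU1P[->//|/jmax].
    by move/le_trans; apply.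
  exists j; rewrite ?inE ?js ?orbT// => i; rewrite inE => /predU1P[->|/jmax//].
  exact: ltW.
pose meets i := `[< cube (a j) (l j) `&` cube (a i) (l i) !=set0 >].
pose s1 := [seq i <- s | ~~ meets i].
have mj : meets j.
  by apply/asboolP; exists (a j); split; apply: corner_in_cube; exact/ltW/l0.
have s1s : {subset s1 <= s} by move=> i; rewrite mem_filter => /andP[].
have [||s' [us' ss' ts' cs']] := IH s1.
- apply: leq_trans (sm : size s <= m)%N; rewrite size_filter -(count_predC meets s).
  by rewrite -[X in (X < _)%N]add0n ltn_add2r -has_count; apply/hasP; exists j.
- by move=> i /s1s; exact: l0.
exists (j :: s'); split => /=.
- rewrite us' andbT; apply/negP => /ss'; rewrite mem_filter mj //.
- by move=> i; rewrite inE => /predU1P[->//|/ss'/s1s].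
- have dis i : i \in s' -> ~ (cube (a j) (l j) `&` cube (a i) (l i) !=set0).
    by move=> /ss'; rewrite mem_filter => /andP[+ _]; rewrite /meets => /asboolPn.
  move=> i k /=; rewrite !inE => /predU1P[->|i1] /predU1P[->|k1]//.
  + by move=> /(dis _ k1).
  + by rewrite setIC => /(dis _ i1).
  + exact: ts'.
- move=> i i0; have [mi|mi] := boolP (meets i).
    exists j; first by rewrite mem_head.
    by apply: sub_triple; [exact: jmax|exact/asboolP].
  have [|k ks' ik] := cs' i; first by rewrite mem_filter mi.
  by exists k => //; rewrite inE ks' orbT.
Qed.

(** The cubes with rational corner and sidelength: a sidelength between [3 r / 2]
    and [2 r] leaves a margin of [r / 2] for the choice of the corner. *)
Lemma rational_cubes : exists (a : nat -> Rd R d) (l : nat -> R),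
  forall b r, 0 < r -> exists k, [/\ 0 < l k, l k <= 2 * r &
    cube b r `<=` cube (a k) (l k)].
Proof.
pose J := (d.-tuple rat * rat)%type.
pose dec k : J := odflt ([tuple 0 | _ < d], 0) (unpickle k).
exists (fun k => [tuple ratr (tnth (dec k).1 i) | i < d]).
exists (fun k => ratr (dec k).2) => b r r0.
have [q qr] : exists q : rat, 3 / 2 * r < ratr q < 2 * r.
  have [|q] := @rat_in_itvoo R (3 / 2 * r) (2 * r); first by lra.
  by rewrite in_itv/=; exists q.
have hp i : exists p : rat, tnth b i - r / 2 < ratr p < tnth b i.
  have [|p] := @rat_in_itvoo R (tnth b i - r / 2) (tnth b i); first by lra.
  by rewrite in_itv/=; exists p.
pose p i := projT1 (cid (hp i)).
have pP i : tnth b i - r / 2 < ratr (p i) < tnth b i by rewrite /p; case: cid.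
exists (pickle (([tuple p i | i < d], q) : J)).
have -> : dec (pickle (([tuple p i | i < d], q) : J)) = ([tuple p i | i < d], q).
  by rewrite /dec pickleK.
split => /=; [lra|lra|] => y yb i; rewrite !tnth_mktuple.
by have := yb i; have := pP i; lra.
Qed.

End cubes.

(** * The covering argument *)

Section weighted_masses.
Context {disp : measure_display} {T : measurableType disp} {R : realType}.
Variable mu : {measure set T -> \bar R}.
Implicit Types (h w : T -> R) (E : set T).
Local Open Scope ereal_scope.
Local Notation mass h E := (\int[mu]_(x in E) (h x)%:E).

Lemma measurable_mass h E : measurable_fun setT h ->
  measurable_fun E (fun x => (h x)%:E).
Proof. by move=> mh; apply/measurable_EFinP; exact: measurable_funTS. Qed.

Lemma mass_ge0 h E : (forall x, 0 <= h x)%R -> 0 <= mass h E.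
Proof. by move=> h0; apply: integral_ge0 => x _; rewrite lee_fin. Qed.

Lemma mass_sub h E E' : measurable_fun setT h -> (forall x, 0 <= h x)%R ->
  measurable E -> measurable E' -> E `<=` E' -> mass h E <= mass h E'.
Proof.
move=> mh h0 mE mE' EE'; apply: ge0_subset_integral => //.
  exact: measurable_mass.
by move=> x _; rewrite lee_fin.
Qed.

Lemma mass_le h w E : measurable_fun setT h -> measurable_fun setT w ->
  (forall x, 0 <= h x)%R -> (forall x, h x <= w x)%R -> measurable E ->
  mass h E <= mass w E.
Proof.
move=> mh mw h0 hw mE; apply: ge0_le_integral => //.
- by move=> x _; rewrite lee_fin.
- exact: measurable_mass.
- exact: measurable_mass.
- by move=> x _; rewrite lee_fin.
Qed.

Lemma massZ h (c : R) E : measurable_fun setT h -> (forall x, 0 <= h x)%R ->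
  measurable E -> (0 <= c)%R -> mass (fun x => c * h x)%R E = c%:E * mass h E.
Proof.
move=> mh h0 mE c0; rewrite -ge0_integralZl_EFin//.
- by move=> x _; rewrite lee_fin.
- exact: measurable_mass.
Qed.

Lemma massD h w E : measurable_fun setT h -> (forall x, 0 <= h x)%R ->
  measurable_fun setT w -> (forall x, 0 <= w x)%R ->
  measurable E -> mass (fun x => h x + w x)%R E = mass h E + mass w E.
Proof.
move=> mh h0 mw w0 mE; rewrite -ge0_integralD//.
- by move=> x _; rewrite lee_fin.
- exact: measurable_mass.
- by move=> x _; rewrite lee_fin.
- exact: measurable_mass.
Qed.

Lemma mass_indic h E : measurable E ->
  mass h E = \int[mu]_x ((\1_E x)%:E * (h x)%:E).
Proof.
move=> mE; rewrite integral_mkcond; apply: eq_integral => x _.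
by rewrite patchE indicE; case: ifP; rewrite ?mul1e ?mul0e.
Qed.

Lemma mass_bigsetU (I : eqType) (F : I -> set T) h (s : seq I) :
  measurable_fun setT h -> (forall x, 0 <= h x)%R ->
  (forall i, measurable (F i)) -> uniq s -> trivIset [set` s] F ->
  mass h (\big[setU/set0]_(i <- s) F i) = \sum_(i <- s) mass h (F i).
Proof.
move=> mh h0 mF us tF; rewrite ge0_integral_bigsetU//.
  exact: measurable_mass.
by move=> x _; rewrite lee_fin.
Qed.

Lemma mass_bigsetU_le (I : eqType) (F : I -> set T) h (s : seq I) :
  measurable_fun setT h -> (forall x, 0 <= h x)%R ->
  (forall i, measurable (F i)) ->
  mass h (\big[setU/set0]_(i <- s) F i) <= \sum_(i <- s) mass h (F i).
Proof.
move=> mh h0 mF; elim: s => [|i s IH].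
  by rewrite !big_nil integral_set0.
rewrite !big_cons; set B := \big[setU/set0]_(j <- s) F j.
have mB : measurable B by exact: bigsetU_measurable.
have mD := measurableD mB (mF i).
rewrite -(setDUK (@subsetUl _ (F i) B)).
rewrite ge0_integral_setU//=; last 4 first.
- by apply: measurableD => //; exact: measurableU.
- exact: measurable_mass.
- by move=> x _; rewrite lee_fin.
- by rewrite disj_set2E setDIK.
apply: leeD2l; apply: le_trans IH; apply: mass_sub => //.
  by apply: measurableD => //; exact: measurableU.
by move=> x [[]//].
Qed.

(** What the covering argument needs of cubes and of their triples; it does not
    depend on the geometry otherwise. *)
Definition vitali_family (P : set nat) (Q Q' : nat -> set T) :=
  [/\ forall k, measurable (Q k), forall k, measurable (Q' k) &
   forall s : seq nat, (forall k, k \in s -> P k) ->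
   exists s', [/\ uniq s', {subset s' <= s}, trivIset [set` s'] Q &
     forall i, i \in s -> exists2 j, j \in s' & Q i `<=` Q' j]].

Section covering.
Variables (P0 : set nat) (Q Q' : nat -> set T).
Hypothesis vQ : vitali_family P0 Q Q'.

(** The members selected by the Vitali lemma are disjoint, so that their [h]-masses
    add up, and their enlargements cover everything, so that the [w]-masses of the
    enlargements bound that of the union. *)
Lemma covering_le w h (P : set nat) (c : R) :
  measurable_fun setT w -> (forall x, 0 <= w x)%R ->
  measurable_fun setT h -> (forall x, 0 <= h x)%R -> (0 <= c)%R ->
  P `<=` P0 -> (forall k, P k -> mass w (Q' k) <= c%:E * mass h (Q k)) ->
  mass w (\bigcup_(k in P) Q k) <= c%:E * mass h (\bigcup_(k in P) Q k).
Proof.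
move=> mw w0 mh h0 c0 PP0 tri; have [mQ mQ' vitali] := vQ.
set U := \bigcup_(k in P) _.
have mU : measurable U by exact: bigcup_measurable.
(* Vitali selection is finite: it applies to the partial unions [F m]. *)
pose F m := \bigcup_(k in P `&` `I_m) Q k.
have mF m : measurable (F m) by exact: bigcup_measurable.
have FU m : F m `<=` U by move=> x [k [Pk _] xk]; exists k.
have -> : U = \bigcup_m F m.
  apply/seteqP; split => [x [k Pk xk]|x [m _]]; last exact: FU.
  by exists k.+1 => //; exists k => //; split => //=.
have ndF : nondecreasing_seq F.
  move=> m n mn; apply/subsetPset => x [k [Pk km] xk]; exists k => //.
  by split => //=; exact: leq_trans mn.
rewrite [leLHS](_ : _ = limn (fun m => mass w (F m))); last first.
  apply/esym/cvg_lim => //; apply: ge0_nondecreasing_set_cvg_integral => //.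
    by move=> i; exact: measurable_mass.
  by move=> i x _; rewrite lee_fin.
apply: lime_le.
  apply: ereal_nondecreasing_is_cvgn => m n mn; apply: mass_sub => //.
  by apply/subsetPset; exact: ndF.
apply: nearW => m.
pose s := [seq k <- iota 0 m | `[< P k >]].
have sP k : k \in s = `[< P k >] && (k < m)%N by rewrite mem_filter mem_iota add0n.
have [|s' [us' ss' ts' cs']] := vitali s.
  by move=> k; rewrite sP => /andP[/asboolP/PP0].
have s'P k : k \in s' -> P k by move/ss'; rewrite sP => /andP[/asboolP].
have UF : \bigcup_m F m = U.
  apply/seteqP; split => [x [n _]|x [k Pk xk]]; first exact: FU.
  by exists k.+1 => //; exists k => //; split => //=.
apply: (@le_trans _ _ (mass w (\big[setU/set0]_(k <- s') Q' k))).
  apply: mass_sub => //; first exact: bigsetU_measurable.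
  move=> x [k [Pk km] xk]; rewrite -bigcup_seq.
  have [|j js' kj] := cs' k; first by rewrite sP km andbT; exact/asboolP.
  by exists j => //; exact: kj.
apply: (le_trans (mass_bigsetU_le _ _ _ _)) => //.
apply: (@le_trans _ _ (\sum_(k <- s') (c%:E * mass h (Q k)))).
  by rewrite big_seq [leRHS]big_seq; apply: lee_sum => k /s'P; exact: tri.
rewrite -ge0_sume_distrr; last by move=> k _; exact: mass_ge0.
rewrite lee_wpmul2l ?lee_fin// -mass_bigsetU//.
apply: mass_sub => //; [exact: bigsetU_measurable|by rewrite UF|].
by rewrite UF -bigcup_seq => x [k /s'P Pk xk]; exists k.
Qed.

End covering.

End weighted_masses.

(** * Positive weights *)

Section positive_weights.
Context {R : realType} {d : nat}.
Local Notation mu := (leb R d).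
Implicit Types (a : Rd R d) (l : R) (s : Rd R d -> R) (Q : set (Rd R d)).
Local Open Scope ereal_scope.

(** Integrals ignore null sets, so a weight can be modified to be positive
    everywhere; no exceptional set then appears in the estimates. *)
Definition positive_weight s :=
  [/\ measurable_fun setT s, locally_integrableRd s & forall x, (0 < s x)%R].

Section positive_weight.
Variable s : Rd R d -> R.
Hypothesis ws : positive_weight s.

Lemma pweight_meas : measurable_fun setT s. Proof. by case: ws. Qed.
Lemma pweight_gt0 x : (0 < s x)%R. Proof. by case: ws. Qed.
Lemma pweight_ge0 x : (0 <= s x)%R. Proof. exact/ltW/pweight_gt0. Qed.

Lemma wmass_fin Q : cubes Q -> wmass s Q \is a fin_num.
Proof.
by case: ws => _ ls _ cQ; apply: integrable_fin_num; [exact: measurable_cubes|exact: ls].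
Qed.

Lemma wmass_gt0 Q : cubes Q -> 0 < wmass s Q.
Proof.
move=> cQ; have mQ := measurable_cubes cQ.
rewrite lt0e (mass_ge0 mu Q pweight_ge0) andbT.
apply/eqP => sQ.
have : \int[mu]_(x in Q) `|(s x)%:E| = 0.
  rewrite -[RHS]sQ; apply: eq_integral => x _.
  by rewrite gee0_abs// lee_fin pweight_ge0.
move/ae_eq_integral_abs => /(_ mQ).
have ms := measurable_mass (E := Q) pweight_meas.
move=> /(_ ms)[N [mN N0 QN]].
have [l [l0 [a Qal]]] := cQ.
have : mu Q <= mu N.
  apply: le_measure; rewrite ?inE// => x Qx; apply: QN => /= /(_ Qx)[].
  by apply/eqP; rewrite gt_eqF// pweight_gt0.
rewrite N0 Qal; rewrite (leb_cube a (ltW l0)) lee_fin leNgt exprn_gt0//.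
Qed.

Lemma wmassE Q : cubes Q -> exists2 m : R, (0 < m)%R & wmass s Q = m%:E.
Proof.
move=> cQ; exists (fine (wmass s Q)); rewrite ?fineK ?wmass_fin//.
by rewrite -lte_fin fineK ?wmass_fin// wmass_gt0.
Qed.

(** Two doublings, as the intermediate cube has sidelength [2 * l]. *)
Lemma wmass_triple (C : R) : (1 < C)%R ->
  (forall (l l' : R) Q Q', is_cube l Q -> is_cube l' Q' -> Q `<=` Q' ->
    (l' <= 2 * l)%R -> wmass s Q' <= C%:E * wmass s Q) ->
  forall a l, (0 < l)%R -> wmass s (triple a l) <= (C ^+ 2)%:E * wmass s (cube a l).
Proof.
move=> C1 dC a l l0.
have l20 : (0 < 2 * l)%R by rewrite mulr_gt0.
have l30 : (0 < 3 * l)%R by rewrite mulr_gt0.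
apply: (@le_trans _ _ (C%:E * wmass s (cube (shift_corner a l) (2 * l)))).
  apply: (dC (2 * l)%R (3 * l)%R); [exact: is_cube_cube|exact: is_cube_cube| |lra].
  by move=> y yb i; have := yb i; lra.
have C0 : (0 <= C)%R by rewrite ltW// (lt_trans ltr01).
rewrite expr2 EFinM -muleA; apply: lee_wpmul2l; first by rewrite lee_fin.
apply: (dC l (2 * l)%R); [exact: is_cube_cube|exact: is_cube_cube| |lra].
by move=> y yb i; have := yb i; rewrite tnth_mktuple; lra.
Qed.

End positive_weight.
End positive_weights.

(** * Modular inequalities for level sets *)

Section core.
Context {disp : measure_display} {T : measurableType disp} {R : realType}.
Variable mu : {measure set T -> \bar R}.
Local Open Scope ereal_scope.
Local Notation mass h E := (\int[mu]_(x in E) (h x)%:E).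

Lemma zsum_integral (f : int -> T -> \bar R) :
  (forall k, measurable_fun setT (f k)) -> (forall k x, 0 <= f k x) ->
  \int[mu]_x zsum (fun k => f k x) = zsum (fun k => \int[mu]_x f k x).
Proof.
move=> mf f0; rewrite /zsum integral_nneseries//.
- by apply: eq_eseriesr => j _; rewrite ge0_integralD.
- by move=> j; exact: emeasurable_funD.
- by move=> j x _; rewrite adde_ge0.
Qed.

Lemma zsum_mass (c : int -> R) (F : int -> set T) (w : T -> R) :
  (forall k, 0 <= c k)%R -> (forall k, measurable (F k)) ->
  measurable_fun setT w -> (forall x, 0 <= w x)%R ->
  \int[mu]_x (zsum (fun k => (c k * \1_(F k) x)%:E) * (w x)%:E) =
  zsum (fun k => (c k)%:E * mass w (F k)).
Proof.
move=> c0 mF mw w0.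
have term0 k x : 0 <= (c k * \1_(F k) x)%:E by rewrite lee_fin mulr_ge0.
transitivity (\int[mu]_x zsum (fun k => (c k)%:E * ((\1_(F k) x)%:E * (w x)%:E))).
  apply: eq_integral => x _; rewrite muleC -zsumZ//.
  by congr zsum; apply/funext => k; rewrite -!EFinM; congr EFin; ring.
have m1 k : measurable_fun setT (fun x => (\1_(F k) x)%:E * (w x)%:E).
  by apply: emeasurable_funM; apply/measurable_EFinP.
have p1 k x : 0 <= (\1_(F k) x)%:E * (w x)%:E by rewrite mule_ge0// lee_fin.
rewrite zsum_integral.
- congr zsum; apply/funext => k; rewrite mass_indic// ge0_integralZl_EFin//.
- by move=> k; exact: emeasurable_funM.
- by move=> k x; rewrite mule_ge0// lee_fin.
Qed.

Lemma prode_le n (A B : 'I_n -> \bar R) :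
  (forall i, 0 <= A i) -> (forall i, A i <= B i) ->
  \prod_(i < n) A i <= \prod_(i < n) B i.
Proof.
move=> A0 At; suff : 0 <= \prod_(i < n) A i <= \prod_(i < n) B i by case/andP.
elim/big_ind2 : _ => [|x r y q /andP[x0 xr] /andP[y0 yq]|i _].
- by rewrite lee_fin ler01 lexx.
- by rewrite mule_ge0//= lee_pmul.
- by rewrite A0 At.
Qed.

Variables (P0 : set nat) (Q Q' : nat -> set T).
Hypothesis vQ : vitali_family P0 Q Q'.
Variable sigma : T -> R.
Hypothesis msigma : measurable_fun setT sigma.
Hypothesis sigma0 : forall x, (0 <= sigma x)%R.
Hypothesis sigmaQ : forall k, P0 k -> exists2 m : R, (0 < m)%R & mass sigma (Q k) = m%:E.
Variable D : R.
Hypothesis D1 : (1 <= D)%R.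
Hypothesis sigmaQ' : forall k, P0 k -> exists2 m : R, (0 < m)%R & mass sigma (Q' k) = m%:E.
Hypothesis sigmaD : forall k, P0 k -> mass sigma (Q' k) <= D%:E * mass sigma (Q k).

Let D0 : (0 <= D)%R. Proof. exact: le_trans D1. Qed.
Let mQ k : measurable (Q k). Proof. by case: vQ. Qed.

Definition average (g : T -> R) k : \bar R :=
  (mass sigma (Q k))^-1 * mass (fun x => g x * sigma x)%R (Q k).

Definition superlevel (g : T -> R) (t : R) : set T :=
  \bigcup_(k in P0 `&` [set k | t%:E < average g k]) Q k.

Let measurable_superlevel g t : measurable (superlevel g t).
Proof. exact: bigcup_measurable. Qed.

Section one_function.
Variable g : T -> R.
Hypotheses (mg : measurable_fun setT g) (g0 : forall x, (0 <= g x)%R).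

Let trunc (t : R) (x : T) : R := (if t < 2 * g x then g x * sigma x else 0)%R.

Let trunc_ge0 t x : (0 <= trunc t x)%R.
Proof. by rewrite /trunc; case: ifP => // _; rewrite mulr_ge0. Qed.

Let measurable_trunc t : measurable_fun setT (trunc t).
Proof.
apply: measurable_fun_ifT => //; last by exact: measurable_funM.
by apply: measurable_fun_ltr => //; exact: measurable_funM.
Qed.

(** Only the part of [g] above [t / 2] matters for the weak-type inequality at
    height [t]: the rest contributes at most [t / 2] to every average. *)
Lemma weak_type (t : R) : (0 < t)%R ->
  mass sigma (superlevel g t) <= (2 * D / t)%:E * \int[mu]_x (trunc t x)%:E.
Proof.
move=> t0.
have c0 : (0 <= 2 * D / t)%R by rewrite divr_ge0 ?mulr_ge0// ltW.
apply: (@le_trans _ _ ((2 * D / t)%:E * mass (trunc t) (superlevel g t))).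
  apply: (covering_le vQ) => // k [Pk].
  have [m m0 mE] := sigmaQ Pk.
  rewrite /= /average mE inver gt_eqF// => tk.
  have tm : (t * m)%:E <= mass (fun x => g x * sigma x)%R (Q k).
    by rewrite mulrC EFinM -lee_pdivlMl// ltW.
  have {tm} : (t * m)%:E <= mass (trunc t) (Q k) + (t / 2 * m)%:E.
    apply: (le_trans tm); rewrite EFinM -mE -massZ//; last by rewrite divr_ge0 ?ltW.
    rewrite -massD//; last 2 first.
    - exact: measurable_funM.
    - by move=> x; rewrite mulr_ge0// divr_ge0// ltW.
    apply: mass_le => //.
    - exact: measurable_funM.
    - by apply: measurable_funD => //; exact: measurable_funM.
    - by move=> x; rewrite mulr_ge0.
    - move=> x; rewrite /trunc; case: ltP => tg.
        by rewrite lerDl mulr_ge0// divr_ge0// ltW.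
      rewrite add0r ler_wpM2r//; lra.
  move=> H; apply: (le_trans (sigmaD Pk)); rewrite mE.
  have : 0 <= mass (trunc t) (Q k) by apply: mass_ge0.
  case: (mass (trunc t) (Q k)) H => [h|_ _|//].
    rewrite -EFinD -!EFinM !lee_fin => H h0.
    rewrite mulrAC ler_pdivlMr//; have := ler_wpM2l D0 H; lra.
  by rewrite gt0_muley ?leey// lte_fin divr_gt0// mulr_gt0// (lt_le_trans ltr01).
rewrite lee_wpmul2l ?lee_fin//; apply: mass_sub => //.
Qed.

Variables (Phi : R -> R) (L : R).
Hypothesis UPhi : classU Phi.
Local Notation t := (fun k : int => ginv Phi (level L k)).
Hypothesis tL : forall k, (2 * (level L k / t k) <= level L (k + 1) / t (k + 1))%R.

(** Summing the weak-type inequalities at the heights [t k] leaves under the integral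
    a sum over the [k] with [t k < 2 g] of terms growing geometrically, of which
    only the largest counts. *)
Lemma modular_superlevel :
  zsum (fun k => (level L k)%:E * mass sigma (superlevel g (t k))) <=
  (2 * D)%:E * \int[mu]_x (Phi (2 * g x) * sigma x)%:E.
Proof.
have gPhi := classU_growth UPhi.
have t0 k : (0 < t k)%R by rewrite ginv_gt0 ?level_gt0.
have l0 k : (0 < level L k / t k)%R by rewrite divr_gt0 ?level_gt0.
pose f k x := ((level L k / t k) * trunc (t k) x)%:E.
have f0 k x : 0 <= f k x by rewrite lee_fin mulr_ge0// ltW.
have mf k : measurable_fun setT (f k) by apply/measurable_EFinP; exact: measurable_funM.
apply: (@le_trans _ _ (zsum (fun k => (2 * D)%:E * \int[mu]_x f k x))).
  apply: le_zsum => k; first by rewrite mule_ge0 ?mass_ge0// lee_fin ltW ?level_gt0.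
  apply: (@le_trans _ _ ((level L k)%:E * ((2 * D / t k)%:E * \int[mu]_x (trunc (t k) x)%:E))).
    by apply: lee_wpmul2l; [rewrite lee_fin ltW ?level_gt0|exact: weak_type].
  have -> : \int[mu]_x f k x = (level L k / t k)%:E * \int[mu]_x (trunc (t k) x)%:E.
    rewrite -ge0_integralZl_EFin//.
    - by move=> x _; rewrite lee_fin.
    - exact/measurable_EFinP.
    - exact: ltW.
  by rewrite !muleA -!EFinM; apply/eq_leW; congr (_%:E * _); ring.
rewrite zsumZ ?mulr_ge0//; last by move=> k; exact: integral_ge0.
apply: lee_wpmul2l; first by rewrite lee_fin mulr_ge0.
rewrite -zsum_integral//; apply: ge0_le_integralT => [x|x].
  by apply: nneseries_ge0 => j _ _; rewrite adde_ge0.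
have [gx|gx] := leP (g x) 0%R.
  have gx0 : g x = 0%R by apply/le_anti; rewrite gx g0.
  rewrite gx0 mulr0 (growth0 gPhi) mul0r; apply: zsum_le => // m.
  by rewrite big1// => j _; rewrite /f /trunc gx0 mul0r if_same mulr0.
pose c k := (t k < 2 * g x)%R.
rewrite (_ : (fun k => f k x) = fun k =>
    (if c k then g x * sigma x * (level L k / t k) else 0)%:E); last first.
  by apply/funext => k; rewrite /f /trunc /c; case: ifP => _; rewrite ?mulr0 1?mulrC //.
have gs0 : (0 <= g x * sigma x)%R by rewrite mulr_ge0.
have g2 : (0 < 2 * g x)%R by rewrite mulr_gt0.
apply: (@le_trans _ _ (2 * (g x * sigma x * (Phi (2 * g x) / (2 * g x))))%:E).
  apply: zsum_geometric.
  - apply: mulr_ge0 => //; apply: divr_ge0; last exact: ltW.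
    by apply: (growth_ge0 gPhi); exact: ltW.
  - by move=> k; rewrite mulr_ge0// ltW.
  - by move=> k; rewrite mulrCA ler_wpM2l.
  - move=> k ck; rewrite ler_wpM2l//.
    rewrite -{1}(ginvK gPhi (ltW (level_gt0 L k))).
    by apply: (classU_ratio UPhi) => //; exact: ltW.
rewrite lee_fin; apply/eq_leW; field; rewrite gt_eqF//.
Qed.

End one_function.

Variables (omega : T -> R) (n : nat) (Phis : 'I_n -> R -> R) (Psi Phi : R -> R).
Variables (L A : R) (g : 'I_n -> T -> R).
Hypothesis momega : measurable_fun setT omega.
Hypothesis omega0 : forall x, (0 <= omega x)%R.
Hypothesis n0 : (0 < n)%N.
Hypothesis UPhis : forall i, classU (Phis i).
Hypothesis UPsi : classU Psi.
Hypothesis PhiK : forall y : R, (0 <= y -> Phi (ginv Phi y) = y)%R.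
Hypothesis hPhiinv : forall y : R, (0 <= y)%R ->
      ginv Phi y = (\prod_(i < n) ginv (Phis i) y)%R.
Hypothesis hincr : forall s t : R, (0 < s -> s <= t -> Psi s / Phi s <= Psi t / Phi t)%R.
Hypothesis phisL : forall i k, (2 * (level L k / ginv (Phis i) (level L k)) <=
  level L (k + 1) / ginv (Phis i) (level L (k + 1)))%R.
Hypothesis omegaA : forall k, P0 k -> forall m : R, mass sigma (Q' k) = m%:E ->
  mass omega (Q' k) * (Psi (ginv Phi m^-1))%:E <= A%:E.
Hypothesis A0 : (0 <= A)%R.
Hypothesis mg : forall i, measurable_fun setT (g i).
Hypothesis g0 : forall i x, (0 <= g i x)%R.
Hypothesis gmod : forall i,
  \int[mu]_x (Phis i (2 * g i x) * sigma x)%:E <= ((2 * D ^+ 2 * n%:R)^-1)%:E.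

Local Notation lam := (fun k => ginv Phi (level L k)).

Definition product_superlevel (t : R) : set T :=
  \bigcup_(j in P0 `&` [set j | t%:E < \prod_(i < n) average (g i) j]) Q j.
Local Notation EE := product_superlevel.

Lemma measurable_product_superlevel t : measurable (EE t).
Proof. exact: bigcup_measurable. Qed.
Let mEE := measurable_product_superlevel.

Let average_ge0 i k : 0 <= average (g i) k.
Proof.
rewrite mule_ge0 ?inve_ge0 ?mass_ge0// => x.
by rewrite mulr_ge0.
Qed.

Let EE_sub k : EE (lam k) `<=`
  \big[setU/set0]_(i < n) superlevel (g i) (ginv (Phis i) (level L k)).
Proof.
move=> x [j [Pj /= ltj] Qj]; rewrite -bigcup_seq.
have [[i ti]|nex] := pselect (exists i, (ginv (Phis i) (level L k))%:E < average (g i) j).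
  by exists i => /=; [rewrite mem_index_enum|exists j].
exfalso; move: ltj; rewrite hPhiinv; last exact/ltW/level_gt0.
apply/negP; rewrite -leNgt.
rewrite -prodEFin; apply: prode_le => // i; rewrite leNgt; apply/negP => ti.
by apply: nex; exists i.
Qed.

(** Since [Phi^-1] is the product of the [Phi_i^-1], a product of averages can only
    exceed [Phi^-1 u] if one of them exceeds its own [Phi_i^-1 u]; the bound on the
    modulars is what makes the [n] contributions add up to [1 / D]. *)
Lemma modular_product_superlevel :
  zsum (fun k => (level L k)%:E * mass sigma (EE (lam k))) <= (D^-1)%:E.
Proof.
have Dp : (0 < D)%R by exact: lt_le_trans D1.
have l0 k : 0 <= (level L k)%:E by rewrite lee_fin ltW ?level_gt0.
apply: (@le_trans _ _ (zsum (fun k => \sum_(i < n) (level L k)%:E *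
    mass sigma (superlevel (g i) (ginv (Phis i) (level L k)))))).
  apply: le_zsum => k; first by rewrite mule_ge0 ?mass_ge0.
  rewrite -ge0_sume_distrr => [|i _]; last exact: mass_ge0.
  apply: lee_wpmul2l => //.
  apply: le_trans (mass_bigsetU_le mu _ msigma sigma0 _) => //.
  by apply: mass_sub => //; exact: bigsetU_measurable.
rewrite zsum_sum => [|i k]; last by rewrite mule_ge0 ?mass_ge0.
apply: (@le_trans _ _ (\sum_(i < n) ((D * n%:R)^-1)%:E)).
  apply: lee_sum => i _.
  apply: (le_trans (modular_superlevel (mg i) (g0 i) (UPhis i) (phisL i))).
  apply: le_trans (lee_wpmul2l _ (gmod i)) _; first by rewrite lee_fin mulr_ge0.
  rewrite -EFinM lee_fin; apply/eq_leW; field.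
  by rewrite pnatr_eq0 -lt0n n0 gt_eqF.
rewrite sumEFin lee_fin big_const_ord iter_addr_0 -mulr_natr.
by apply/eq_leW; field; rewrite pnatr_eq0 -lt0n n0 gt_eqF.
Qed.

(** A cube [Q j] of the level set at height [lam k = Phi^-1 u] has [u sigma(Q' j) <= 1],
    so that monotonicity of [Psi / Phi] turns the hypothesis on [omega (Q' j)] into
    [Psi (lam k) omega(Q' j) <= A D u sigma(Q j)]; the covering argument then
    compares the two distribution functions at the same height. *)
Lemma omega_product_superlevel k :
  (Psi (lam k))%:E * mass omega (EE (lam k)) <=
  (A * D)%:E * ((level L k)%:E * mass sigma (EE (lam k))).
Proof.
have Dp : (0 < D)%R by exact: lt_le_trans D1.
have u0 := level_gt0 L k; set u := level L k.
have lam0 : (0 < lam k)%R.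
  rewrite hPhiinv; last exact: ltW.
  apply: prodr_gt0 => i _; exact: ginv_gt0.
have P0' : (0 < Psi (lam k))%R by exact: classU_gt0.
pose c := (A * D * u / Psi (lam k))%R.
have c0 : (0 <= c)%R.
  by apply: divr_ge0; [rewrite !mulr_ge0// ltW|exact: ltW].
suff H : mass omega (EE (lam k)) <= c%:E * mass sigma (EE (lam k)).
  apply: (@le_trans _ _ ((Psi (lam k))%:E * (c%:E * mass sigma (EE (lam k))))).
    by apply: lee_wpmul2l => //; rewrite lee_fin ltW.
  rewrite !muleA -!EFinM; apply/eq_leW; congr (_%:E * _).
  by rewrite /c; field; rewrite gt_eqF.
apply: (covering_le vQ) => // j [Pj ltj].
have [m m0 mE] := sigmaQ Pj; have [m' m'0 m'E] := sigmaQ' Pj.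
(* [Q j] is contained in the level set, whose [sigma]-mass is at most [1 / (D u)]. *)
have um : (u * m <= D^-1)%R.
  rewrite -lee_fin EFinM -mE; apply: le_trans modular_product_superlevel.
  apply: (@le_trans _ _ (u%:E * mass sigma (EE (lam k)))).
    apply: lee_wpmul2l; first by rewrite lee_fin ltW.
    by apply: mass_sub => // x Qx; exists j.
  apply: (@zsum_ge _ (fun k => (level L k)%:E * mass sigma (EE (lam k)))) => i.
  by rewrite mule_ge0 ?mass_ge0// lee_fin ltW ?level_gt0.
have m'm : (m' <= D * m)%R.
  by rewrite -lee_fin -m'E EFinM -mE; exact: sigmaD.
have um' : (u <= m'^-1)%R.
  rewrite -(ler_pM2r m'0) mulVf ?gt_eqF//.
  apply: (@le_trans _ _ (u * (D * m))%R); first by rewrite ler_pM2l.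
  by rewrite mulrCA -(mulfV (lt0r_neq0 Dp)) ler_pM2l.
have m'V : (0 < m'^-1)%R by rewrite invr_gt0.
pose b := ginv Phi m'^-1.
have lamb : (lam k <= b)%R.
  rewrite /b !hPhiinv; [|exact: ltW|exact: ltW].
  apply: ler_prod => i _; apply/andP; split.
    by apply: ginv_ge0; [exact: classU_growth|exact: ltW].
  by apply: ginv_le => //; exact: ltW.
have := hincr lam0 lamb; rewrite /b !PhiK; [|exact: ltW|exact: ltW]; rewrite invrK -/b => Pb.
have Pb0 : (0 < Psi b)%R by apply: classU_gt0 => //; exact: lt_le_trans lamb.
have := omegaA Pj m'E; rewrite -/b.
have : 0 <= mass omega (Q' j) by exact: mass_ge0.
case: (mass omega (Q' j)) => [w||//]; last first.
  by rewrite gt0_mulye ?lte_fin// => _; rewrite leye_eq.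
rewrite mE -!EFinM !lee_fin => w0 wA.
rewrite /c mulrAC ler_pdivlMr//.
have h1 : (Psi (lam k) <= Psi b * m' * u)%R by rewrite -ler_pdivrMr.
apply: (@le_trans _ _ (w * (Psi b * m' * u))%R); first by rewrite ler_wpM2l.
rewrite (_ : w * _ = (w * Psi b) * (u * m'))%R; last by ring.
rewrite (_ : A * D * u * m = A * (u * (D * m)))%R; last by ring.
by apply: ler_pM => //; rewrite ?mulr_ge0 ?ler_pM2l// ltW.
Qed.

Lemma modular_omega :
  zsum (fun k => (Psi (lam k))%:E * mass omega (EE (lam k))) <= A%:E.
Proof.
have Dp : (0 < D)%R by exact: lt_le_trans D1.
have Psi0 k : 0 <= (Psi (lam k))%:E.
  rewrite lee_fin; apply: (growth_ge0 (classU_growth UPsi)).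
  rewrite hPhiinv; last exact/ltW/level_gt0.
  apply: prodr_ge0 => i _.
  by apply: ginv_ge0; [exact: classU_growth|rewrite ltW ?level_gt0].
apply: (@le_trans _ _ (zsum (fun k => (A * D)%:E *
    ((level L k)%:E * mass sigma (EE (lam k)))))).
  by apply: le_zsum => k; [rewrite mule_ge0 ?mass_ge0|exact: omega_product_superlevel].
rewrite zsumZ ?mulr_ge0//; last first.
  by move=> k; rewrite mule_ge0 ?mass_ge0// lee_fin ltW ?level_gt0.
apply: (@le_trans _ _ ((A * D)%:E * (D^-1)%:E)).
  by apply: lee_wpmul2l; [rewrite lee_fin mulr_ge0|exact: modular_product_superlevel].
by rewrite -EFinM lee_fin -mulrA divff ?mulr1// gt_eqF.
Qed.

End core.

(** * Luxemburg norms *)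

Section luxemburg.
Context {R : realType} {d : nat}.
Local Notation mu := (leb R d).
Implicit Types (s : Rd R d -> R).
Local Open Scope ereal_scope.

Lemma dive_EFin (x : \bar R) (l : R) : (0 < l)%R -> x / l%:E = (l^-1)%:E * x.
Proof. by move=> l0; rewrite inver gt_eqF// muleC. Qed.

Lemma lux_lt Phi s (g : Rd R d -> \bar R) (l : \bar R) : lux Phi s g < l ->
  exists2 r : R, (0 < r)%R /\ r%:E < l &
    \int[mu]_x (ext Phi (g x / r%:E) * (s x)%:E) <= 1.
Proof. by move=> /ereal_inf_lt[_ [r [r0 Hr] <-] rl]; exists r. Qed.

Lemma lux_le Phi s (g : Rd R d -> \bar R) (r : R) : (0 < r)%R ->
  \int[mu]_x (ext Phi (g x / r%:E) * (s x)%:E) <= 1 -> lux Phi s g <= r%:E.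
Proof. by move=> r0 Hr; apply: ereal_inf_lbound; exists r. Qed.

Lemma lux_ge0 Phi s (g : Rd R d -> \bar R) : 0 <= lux Phi s g.
Proof. by apply: le_ereal_inf_tmp => _ [r [r0 _] <-]; rewrite lee_fin ltW. Qed.

Lemma modulus_ge0 (f : Rd R d -> R[i]) x : (0 <= modulus f x)%R.
Proof. by rewrite /modulus; case: (f x) => a b /=; exact: sqrtr_ge0. Qed.

Lemma measurable_modulus (f : Rd R d -> R[i]) : Defs.measurableC f ->
  measurable_fun setT (modulus f).
Proof.
move=> [mre mim].
rewrite (_ : modulus f = Num.sqrt \o
    (fun x => complex.Re (f x) ^+ 2 + complex.Im (f x) ^+ 2)%R); last first.
  by apply/funext => x; rewrite /modulus /=; case: (f x).
apply: measurableT_comp; first by apply: continuous_measurable_fun; exact: sqrt_continuous.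
by apply: measurable_funD; apply: measurable_funX.
Qed.

(** Any [l] above the norm is admissible in the infimum that defines it, and
    dividing [f] further by [B >= 1] divides the modular by at least [B]; the factors
    [2] cancel and prepare the [2 g] of [modular_superlevel]. *)
Lemma modular_scale Phi s (f : Rd R d -> R[i]) (l B : R) : classU Phi ->
  positive_weight s -> Defs.measurableC f -> luxC Phi s f < l%:E -> (1 <= B)%R ->
  (0 < l)%R /\
  \int[mu]_x (Phi (2 * (modulus f x / (2 * l * B))) * s x)%:E <= (B^-1)%:E.
Proof.
move=> UPhi ws mf fl B1; have gPhi := classU_growth UPhi.
have [r [r0]] := lux_lt fl; rewrite lte_fin => rl Hr.
have l0 := lt_trans r0 rl; split => //.
have B0 : (0 < B)%R by exact: lt_le_trans B1.
pose h x : R := (Phi (Num.max 0 (modulus f x / r)) * s x)%R.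
have md x : (0 <= modulus f x / r)%R by rewrite divr_ge0 ?modulus_ge0// ltW.
have hE x : h x = (Phi (modulus f x / r) * s x)%R by rewrite /h max_r.
have h0 x : (0 <= h x)%R.
  by rewrite hE mulr_ge0 ?(pweight_ge0 ws)// growth_ge0.
have mh : measurable_fun setT h.
  apply: measurable_funM; last exact: pweight_meas.
  have mPhi : measurable_fun setT (fun y : R => Phi (Num.max 0 y)%R).
    apply: nondecreasing_measurable => // x y xy; apply: (growth_le gPhi).
      by rewrite le_max lexx.
    by rewrite ge_max !le_max lexx xy orbT.
  apply: (measurableT_comp mPhi).
  apply: measurable_funM; last exact: measurable_cst.
  exact: measurable_modulus.
apply: (@le_trans _ _ (\int[mu]_x (B^-1 * h x)%:E)).
  apply: ge0_le_integralT => x.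
    rewrite lee_fin mulr_ge0 ?(pweight_ge0 ws)// growth_ge0//.
    by rewrite mulr_ge0// divr_ge0 ?modulus_ge0// !mulr_ge0// ltW.
  rewrite lee_fin hE [leRHS]mulrA ler_wpM2r ?(pweight_ge0 ws)// [leRHS]mulrC.
  apply: le_trans (classU_scaleV UPhi B1 (md x)).
  apply: (growth_le gPhi).
    by rewrite mulr_ge0// divr_ge0 ?modulus_ge0// !mulr_ge0// ltW.
  rewrite (_ : 2 * _ = modulus f x / l / B)%R; last by field; rewrite !gt_eqF.
  rewrite ler_wpM2r ?invr_ge0 ?(ltW B0)// ler_wpM2l ?modulus_ge0//.
  by rewrite lef_pV2 ?posrE// ltW.
have BV0 : (0 <= B^-1)%R by rewrite invr_ge0 ltW.
rewrite (massZ mu mh h0 measurableT BV0) -[leRHS]mule1; apply: lee_wpmul2l; first by rewrite lee_fin.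
apply: le_trans Hr; apply/eq_leW; apply: eq_integral => x _.
by rewrite dive_EFin//= hE EFinM mulrC.
Qed.

End luxemburg.

Section perturbation.
Context {R : realType}.

Lemma prod_perturb n (r : 'I_n -> R) : (forall i, 0 <= r i) ->
  exists2 M, 0 <= M & forall e, 0 <= e <= 1 ->
    \prod_(i < n) (r i + e) <= \prod_(i < n) r i + e * M.
Proof.
elim: n r => [|n IH] r r0.
  by exists 0 => // e _; rewrite !big_ord0 mulr0 addr0.
have [M M0 HM] := IH (fun i => r (lift ord0 i)) (fun i => r0 _).
pose P := \prod_(i < n) r (lift ord0 i).
have P0 : 0 <= P by apply: prodr_ge0 => i _; exact: r0.
exists (P + r ord0 * M + M); first by rewrite !addr_ge0 ?mulr_ge0.
move=> e /[dup] e01 /andP[e0 e1]; rewrite !big_ord_recl -/P.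
apply: (@le_trans _ _ ((r ord0 + e) * (P + e * M))).
  by rewrite ler_wpM2l ?addr_ge0//; exact: HM.
have : 0 <= e * M * (1 - e) by rewrite !mulr_ge0 ?subr_ge0.
nra.
Qed.

(** Continuity of the product, in the form needed for a family of infima. *)
Lemma le_prod_perturb n (r : 'I_n -> R) (K : R) (X : \bar R) :
  (forall i, 0 <= r i) -> 0 <= K ->
  (forall l : 'I_n -> R, (forall i, r i < l i) -> (X <= (K * \prod_(i < n) l i)%:E)%E) ->
  (X <= (K * \prod_(i < n) r i)%:E)%E.
Proof.
move=> r0 K0 HX; apply/lee_addgt0Pr => e e0.
have [M M0 HM] := prod_perturb r0.
have KM : 0 < K * M + 1 by rewrite ltr_wpDl ?mulr_ge0.
pose a := Num.min 1 (e / (K * M + 1)).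
have a0 : 0 < a by rewrite lt_min ltr01 divr_gt0.
have aKM : a * (K * M) <= e.
  apply: (@le_trans _ _ (e / (K * M + 1) * (K * M))).
    by rewrite ler_wpM2r ?mulr_ge0// ge_min lexx orbT.
  by rewrite mulrAC ler_pdivrMr// ler_wpM2l ?(ltW e0)// lerDl.
apply: (le_trans (HX (fun i => r i + a) _)) => [i|]; first by rewrite ltrDl.
rewrite -EFinD lee_fin.
have a01 : 0 <= a <= 1 by rewrite ltW// ge_min lexx.
have := ler_wpM2l K0 (HM a a01); nra.
Qed.

End perturbation.

(** * The maximal function *)

Section positive_case.
Context {R : realType} {d n : nat}.
Local Notation mu := (leb R d).
Local Open Scope ereal_scope.
Hypothesis n0 : (0 < n)%N.
Variables (Phis : 'I_n -> R -> R) (Psi Phi : R -> R) (sigma : Rd R d -> R).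
Hypothesis UPhis : forall i, classU (Phis i).
Hypothesis nPhis : forall i, nabla2 (Phis i).
Hypothesis UtPsi : classUtilde Psi.
Hypothesis hPhi : set_bij Rplus Rplus Phi.
Hypothesis hPhiinv : forall y : R, (0 <= y)%R ->
      ginv Phi y = (\prod_(i < n) ginv (Phis i) y)%R.
Hypothesis hincr : forall s t : R, (0 < s -> s <= t -> Psi s / Phi s <= Psi t / Phi t)%R.
Hypothesis ws : positive_weight sigma.
Hypothesis dsigma : doubling sigma.
Local Notation sigmas := (fun _ : 'I_n => sigma).

Let UPsi : classU Psi.
Proof. by case: UtPsi => q q1 [Uq _ _]; exists q. Qed.
Let gPsi := classU_growth UPsi.

Lemma Phi_ginvK y : (0 <= y)%R -> Phi (ginv Phi y) = y.
Proof.
case: hPhi => fPhi _ sPhi y0; apply: (surjpK _ sPhi).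
by rewrite mem_Rplus.
Qed.

Lemma Phi_ginvVK t : (0 <= t)%R -> ginv Phi (Phi t) = t.
Proof.
case: hPhi => fPhi iPhi _ t0; apply: pinvKV => //.
by rewrite mem_Rplus.
Qed.

Lemma Phi_ge0 t : (0 <= t)%R -> (0 <= Phi t)%R.
Proof. by case: hPhi => fPhi _ _ t0; have := fPhi t; rewrite !RplusE; apply. Qed.

Lemma Phi_ginv_gt0 y : (0 < y)%R -> (0 < ginv Phi y)%R.
Proof.
move=> y0; rewrite hPhiinv; last exact: ltW.
by apply: prodr_gt0 => i _; exact: ginv_gt0.
Qed.

Lemma Phi_ginv_le x y : (0 <= x)%R -> (x <= y)%R -> (ginv Phi x <= ginv Phi y)%R.
Proof.
move=> x0 xy; rewrite !hPhiinv//; last exact: le_trans xy.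
apply: ler_prod => i _; apply/andP; split.
  by apply: ginv_ge0 => //; exact: classU_growth.
exact: ginv_le.
Qed.

Lemma Phi_gt0 t : (0 < t)%R -> (0 < Phi t)%R.
Proof.
move=> t0; rewrite lt0r Phi_ge0 ?(ltW t0)// andbT; apply/eqP => Pt.
have := Phi_ginvVK (ltW t0); rewrite Pt hPhiinv// (bigD1 (Ordinal n0))//=.
by rewrite ginv0// mul0r => t00; rewrite -t00 ltxx in t0.
Qed.

Lemma nu_positive (x : Rd R d) : nu Phi Phis sigmas x = sigma x.
Proof.
have sV : (0 <= (sigma x)^-1)%R by rewrite invr_ge0 (pweight_ge0 ws).
by rewrite /nu -hPhiinv// Phi_ginvK// invrK.
Qed.

(** The common ratio [expR L] of the heights is so large that multiplying [u] by it
    multiplies each [Phi_i^-1 u] at least by the constant of [nabla2_doubling]. *)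
Lemma levels_exist : exists2 L : R, (0 < L)%R &
  forall i k, (2 * (level L k / ginv (Phis i) (level L k)) <=
    level L (k + 1) / ginv (Phis i) (level L (k + 1)))%R.
Proof.
pose N i := projT1 (cid2 (nabla2_doubling (UPhis i) (nPhis i))).
have N1 i : (1 <= N i)%R by rewrite /N; case: cid2.
have NP i t : (0 < t)%R -> (2 * (Phis i t / t) <= Phis i (N i * t) / (N i * t))%R.
  by rewrite /N; case: cid2 => //= x _ h; exact: h.
pose K i := projT1 (cid2 (classU_upper (UPhis i) (N1 i))).
have K1 i : (1 <= K i)%R by rewrite /K; case: cid2.
have KP i t : (0 <= t)%R -> (Phis i (N i * t) <= K i * Phis i t)%R.
  by rewrite /K; case: cid2 => //= x _ h; exact: h.
have lK i : (0 <= ln (K i))%R by exact: ln_ge0.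
pose L := (1 + \sum_(i < n) ln (K i))%R.
have L0 : (0 < L)%R by rewrite ltr_pwDl// sumr_ge0.
exists L => // i k.
have KL : (K i <= expR L)%R.
  rewrite -[leLHS]lnK ?posrE ?(lt_le_trans ltr01)// ler_expR /L (bigD1 i)//=.
  rewrite addrCA lerDl addr_ge0// sumr_ge0//.
have u0 := level_gt0 L k; have u1 := level_gt0 L (k + 1).
have gi := classU_growth (UPhis i).
set t := ginv _ _; set t' := ginv _ _.
have t0 : (0 < t)%R by exact: ginv_gt0.
have Pt : Phis i t = level L k by rewrite ginvK// ltW.
have Pt' : Phis i t' = level L (k + 1) by rewrite ginvK// ltW.
have Nt0 : (0 < N i * t)%R by rewrite mulr_gt0// (lt_le_trans ltr01).
have Ntt' : (N i * t <= t')%R.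
  apply: (classU_leW (UPhis i)); [exact: ltW|exact/ginv_ge0/ltW|].
  rewrite Pt' levelS; apply: (le_trans (KP i t (ltW t0))).
  by rewrite Pt ler_wpM2r ?(ltW u0).
rewrite -{1}Pt -Pt'; apply: (le_trans (NP i t t0)).
exact: (classU_ratio (UPhis i)).
Qed.

Section upper.
Variables (a : nat -> Rd R d) (l : nat -> R).
Hypothesis rat_cubes : forall b r, (0 < r)%R -> exists k,
  [/\ (0 < l k)%R, (l k <= 2 * r)%R & cube b r `<=` cube (a k) (l k)].
Variable C : R.
Hypothesis C1 : (1 < C)%R.
Hypothesis dC : forall (l l' : R) Q Q', is_cube l Q -> is_cube l' Q' -> Q `<=` Q' ->
    (l' <= 2 * l)%R -> wmass sigma Q' <= C%:E * wmass sigma Q.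
Variable L : R.
Hypothesis L0 : (0 < L)%R.
Hypothesis phisL : forall i k, (2 * (level L k / ginv (Phis i) (level L k)) <=
  level L (k + 1) / ginv (Phis i) (level L (k + 1)))%R.

Let C0 : (0 < C)%R. Proof. exact: lt_trans C1. Qed.

Definition valid : set nat := [set k | (0 < l k)%R].
Let Q k : set (Rd R d) := cube (a k) (l k).
Let Q' k : set (Rd R d) := triple (a k) (l k).

Let vQ : vitali_family valid Q Q'.
Proof.
split; [by move=> k; exact: measurable_cube|by move=> k; exact: measurable_cube|].
by move=> s sP; apply: vitali_cubes => i /sP.
Qed.

Local Notation EE := (product_superlevel mu valid Q sigma).
Local Notation lam := (fun k : int => ginv Phi (level L k)).

Section pointwise.
Variables (f : 'I_n -> Rd R d -> R[i]) (c : 'I_n -> R).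
Hypothesis mf : forall i, Defs.measurableC (f i).
Hypothesis c0 : forall i, (0 < c i)%R.
Let g i x : R := (modulus (f i) x / c i)%R.
(* [C] is lost on each average in passing to the countable family of cubes, and
   [c i] undoes the normalisation of [f i]. *)
Local Notation K0 := (C ^+ n * \prod_(i < n) c i)%R.

Let g0 i x : (0 <= g i x)%R.
Proof. by rewrite divr_ge0 ?modulus_ge0// ltW. Qed.

Let mg i : measurable_fun setT (g i).
Proof.
apply: measurable_funM; last exact: measurable_cst.
exact: measurable_modulus.
Qed.

Lemma maximal_ge0 (x : Rd R d) : 0 <= maximal sigmas f x.
Proof.
have c1 := @cubes_cube R d x 1 ltr01.
apply: le_ereal_sup_tmp; eexists; first by exists (cube x 1).
apply: prode_ge0 => i _; rewrite mule_ge0//.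
  by rewrite mule_ge0 ?lee_fin// inve_ge0 ltW// wmass_gt0.
apply: integral_ge0 => y _.
by rewrite lee_fin mulr_ge0 ?modulus_ge0 ?(pweight_ge0 ws).
Qed.

(** Every cube is contained in a cube of the countable family whose [sigma]-mass
    is at most [C] times larger, so that the averages over the latter control the maximal function. *)
Lemma maximal_superlevel (x : Rd R d) (v : R) : (0 <= v)%R ->
  (K0 * v)%:E < maximal sigmas f x -> EE g v x.
Proof.
move=> v0 /ereal_sup_gt[_ [B [r [r0 [b ->]]] <-]] HB.
have K0p : (0 < K0)%R by rewrite mulr_gt0 ?exprn_gt0// prodr_gt0.
have cB : cubes (cube b r) by exact: cubes_cube.
have xB : cube b r x.
  apply: contrapT => xB; move: HB.
  rewrite [X in _ < X -> _](bigD1 (Ordinal n0))//=.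
  have -> : (\1_(cube b r) x = 0 :> R)%R by rewrite indicE memNset.
  rewrite !mul0e; apply/negP; rewrite -leNgt lee_fin.
  by rewrite mulr_ge0// ltW.
have [k [lk0 lk2 Bk]] := rat_cubes b r0.
have cQ : cubes (Q k) by exact: cubes_cube.
exists k; last exact: Bk.
split; first exact: lk0.
have [m m0 mE] := wmassE ws cB; have [m' m'0 m'E] := wmassE ws cQ.
have m'm : (m' <= C * m)%R.
  rewrite -lee_fin EFinM -mE -m'E; apply: dC; [exact: is_cube_cube|exact: is_cube_cube| |] => //.
have K0E : K0 = (\prod_(i < n) (C * c i))%R.
  by rewrite big_split/= prodr_const card_ord.
have : (K0 * v)%:E < K0%:E * \prod_(i < n) average mu Q sigma (g i) k.
  apply: (lt_le_trans HB); rewrite K0E -prodEFin -big_split/=.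
  apply: prode_le => i.
    rewrite mule_ge0//; last first.
      by apply: mass_ge0 => y; rewrite mulr_ge0 ?modulus_ge0 ?(pweight_ge0 ws).
    by rewrite mule_ge0 ?lee_fin// mE inve_ge0 lee_fin ltW.
  have -> : (\1_(cube b r) x = 1 :> R)%R by rewrite indicE mem_set.
  rewrite mul1e mE /average.
  have -> : \int[mu]_(y in Q k) (sigma y)%:E = m'%:E by exact: m'E.
  rewrite !inver !gt_eqF//.
  have mgs : measurable_fun setT (fun y => g i y * sigma y)%R.
    by apply: measurable_funM; [exact: mg|exact: pweight_meas].
  have gs0 y : (0 <= g i y * sigma y)%R by rewrite mulr_ge0 ?(pweight_ge0 ws).
  have cgE : (fun y => modulus (f i) y * sigma y)%R = (fun y => c i * (g i y * sigma y))%R.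
    by apply/funext => y; rewrite /g; field; rewrite gt_eqF.
  have -> : \int[mu]_(y in cube b r) (modulus (f i) y * sigma y)%:E =
      (c i)%:E * \int[mu]_(y in cube b r) (g i y * sigma y)%:E.
    rewrite -(massZ mu mgs gs0 (measurable_cube b r) (ltW (c0 i))).
    by rewrite -[in RHS]/(wmass _ _) -cgE.
  have I0 : 0 <= \int[mu]_(y in Q k) (g i y * sigma y)%:E by exact: mass_ge0.
  apply: (@le_trans _ _ ((m^-1)%:E * ((c i)%:E * \int[mu]_(y in Q k) (g i y * sigma y)%:E))).
    apply: lee_wpmul2l; first by rewrite lee_fin invr_ge0 ltW.
    apply: lee_wpmul2l; first by rewrite lee_fin ltW.
    exact: (mass_sub mu mgs gs0 (measurable_cube b r) (measurable_cube _ _) Bk).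
  rewrite !muleA -!EFinM lee_wpmul2r// lee_fin.
  rewrite [leRHS]mulrAC [leLHS]mulrC [leRHS]mulrC ler_pM2l//.
  by rewrite ler_pdivlMr// mulrC ler_pdivrMr.
by rewrite EFinM lte_pmul2l// lte_fin.
Qed.

Variables (Lam Kd : R).
Hypothesis Lam0 : (0 < Lam)%R.
Hypothesis Kd1 : (1 <= Kd)%R.
Hypothesis KdP : forall s t, (0 <= s)%R -> (0 < t)%R -> (Psi (s * t) <= Kd * Psi s * Psi t)%R.
Variable Ku : R.
Hypothesis Ku1 : (1 <= Ku)%R.
Hypothesis KuP : forall t, (0 <= t)%R -> (Psi (expR L ^+ n * t) <= Ku * Psi t)%R.

Let lamS k : (lam (k + 1)%R <= expR L ^+ n * lam k)%R.
Proof.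
rewrite /= !hPhiinv; [|exact/ltW/level_gt0|exact/ltW/level_gt0].
rewrite -[X in (_ ^+ X)%R](card_ord n) -prodr_const -big_split/=.
apply: ler_prod => i _; apply/andP; split.
  by apply: ginv_ge0; [exact: classU_growth|exact/ltW/level_gt0].
rewrite levelS; apply: ginv_scale => //; last exact/ltW/level_gt0.
by rewrite -expR0 ler_expR ltW.
Qed.

(** Between two consecutive heights [Psi (M f)] is comparable with its value at the
    lower one, because [lam (k + 1) <= expR L ^+ n * lam k] and [Psi] has upper
    type. *)
Lemma Psi_maximal_le (x : Rd R d) :
  ext Psi (maximal sigmas f x / (K0 * Lam)%:E) <=
  (Kd * Ku * Psi Lam^-1)%:E * zsum (fun k => (Psi (lam k) * \1_(EE g (lam k)) x)%:E).
Proof.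
set Z := zsum _; set K := (Kd * Ku * Psi Lam^-1)%R.
have K0p : (0 < K0)%R by rewrite mulr_gt0 ?exprn_gt0// prodr_gt0.
have lam0 k : (0 < lam k)%R by apply: Phi_ginv_gt0; exact: level_gt0.
have Psil k : (0 < Psi (lam k))%R by exact: classU_gt0.
have PLV : (0 < Psi Lam^-1)%R by apply: classU_gt0 => //; rewrite invr_gt0.
have Kp : (0 < K)%R by rewrite !mulr_gt0// (lt_le_trans ltr01).
have term0 k : 0 <= (Psi (lam k) * \1_(EE g (lam k)) x)%:E.
  by rewrite lee_fin mulr_ge0// ltW.
have step k : (K0 * lam k)%:E < maximal sigmas f x ->
    (Psi (lam (k + 1)%R / Lam))%:E <= K%:E * Z.
  move=> /(maximal_superlevel (ltW (lam0 k))) xE.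
  apply: (@le_trans _ _ (K%:E * (Psi (lam k))%:E)); last first.
    apply: lee_wpmul2l; first by rewrite lee_fin ltW.
    have := @zsum_ge _ (fun k => (Psi (lam k) * \1_(EE g (lam k)) x)%:E) k term0.
    by rewrite indicE mem_set// mulr1.
  rewrite -EFinM lee_fin.
  apply: (le_trans (KdP (ltW (lam0 _)) _)); first by rewrite invr_gt0.
  rewrite (_ : K * _ = Kd * (Ku * Psi (lam k)) * Psi Lam^-1)%R; last by rewrite /K; ring.
  rewrite ler_pM2r// ler_pM2l ?(lt_le_trans ltr01)//.
  apply: le_trans (KuP (ltW (lam0 k))).
  by apply: (growth_le gPsi) => //; exact: ltW.
have Z0 : 0 <= Z by apply: nneseries_ge0 => j _ _; rewrite adde_ge0.
have KL : (0 < K0 * Lam)%R by rewrite mulr_gt0.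
have : 0 <= maximal sigmas f x by exact: maximal_ge0.
have levelb w : (0 < w)%R -> exists k, (lam k < w)%R /\ (w <= lam (k + 1)%R)%R.
  move=> w0; have [k /andP[k1 k2]] := level_between L0 (Phi_gt0 w0).
  exists k; split.
    rewrite ltNge; apply/negP => wk.
    have Plam : Phi (lam k) = level L k by apply: Phi_ginvK; exact/ltW/level_gt0.
    have := Phi_ginv_le (ltW (level_gt0 L k)) (ltW k1).
    rewrite Phi_ginvVK ?(ltW w0)// => lw.
    have wE : w = lam k by apply/le_anti; rewrite wk lw.
    by rewrite {1}wE Plam ltxx in k1.
  by rewrite -[leLHS](Phi_ginvVK (ltW w0)); apply: Phi_ginv_le => //; exact/ltW/Phi_gt0.
case Mx : (maximal sigmas f x) => [v||//] v0.
- rewrite dive_EFin//= lee_fin in v0 *.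
  have [->|vn0] := eqVneq v 0%R.
    by rewrite mulr0 (growth0 gPsi) mule_ge0// lee_fin ltW.
  have vp : (0 < v)%R by rewrite lt0r vn0.
  have [k [k1 k2]] := levelb (v / K0)%R (divr_gt0 vp K0p).
  apply: (le_trans _ (step k _)); last by rewrite Mx lte_fin mulrC -ltr_pdivlMr.
  rewrite lee_fin; apply: (growth_le gPsi).
    by rewrite mulr_ge0// invr_ge0 ltW.
  rewrite (_ : _ * v = v / K0 / Lam)%R; last first.
    by rewrite invfM mulrC mulrA.
  by rewrite ler_pM2r ?invr_gt0.
- rewrite dive_EFin// gt0_muley ?lte_fin ?invr_gt0//=.
  rewrite leye_eq; apply/eqP; apply: eq_infty => y.
  have [y0|y0] := leP y 0%R; first by rewrite (@le_trans _ _ 0)// ?lee_fin// mule_ge0// lee_fin ltW.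
  have [w w0 Pw] := growth_surj gPsi (ltW y0).
  have wp : (0 < w * Lam)%R.
    rewrite mulr_gt0// lt0r w0 andbT; apply/eqP => w00.
    by rewrite -Pw w00 (growth0 gPsi) ltxx in y0.
  have [k [_ k2]] := levelb _ wp.
  apply: le_trans (step k _); last by rewrite Mx ltry.
  rewrite lee_fin -Pw; apply: (growth_le gPsi) => //.
  by rewrite ler_pdivlMr.
Qed.

End pointwise.

Lemma integral_maximal_le f c omega A Lam Kd Ku :
  (forall i, Defs.measurableC (f i)) -> (forall i, (0 < c i)%R) ->
  (0 < Lam)%R -> (1 <= Kd)%R ->
  (forall s t, (0 <= s)%R -> (0 < t)%R -> (Psi (s * t) <= Kd * Psi s * Psi t)%R) ->
  (1 <= Ku)%R -> (forall t, (0 <= t)%R -> (Psi (expR L ^+ n * t) <= Ku * Psi t)%R) ->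
  positive_weight omega -> (0 <= A)%R ->
  (forall B, cubes B -> wmass omega B *
     ext Psi (ext (ginv Phi) (wmass sigma B)^-1) <= A%:E) ->
  (forall i, \int[mu]_x (Phis i (2 * (modulus (f i) x / c i)) * sigma x)%:E <=
     ((2 * (C ^+ 2) ^+ 2 * n%:R)^-1)%:E) ->
  \int[mu]_x (ext Psi (maximal sigmas f x / (C ^+ n * (\prod_(i < n) c i) * Lam)%:E)
    * (omega x)%:E) <= (Kd * Ku * Psi Lam^-1 * A)%:E.
Proof.
move=> mf c0 Lam0 Kd1 KdP Ku1 KuP womega A0 HA Hmod.
pose g i x : R := (modulus (f i) x / c i)%R.
have g0 i x : (0 <= g i x)%R by rewrite divr_ge0 ?modulus_ge0// ltW.
have mg i : measurable_fun setT (g i).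
  by apply: measurable_funM; [exact: measurable_modulus|exact: measurable_cst].
have lam0 k : (0 < lam k)%R by apply: Phi_ginv_gt0; exact: level_gt0.
have Psil k : (0 <= Psi (lam k))%R by exact/ltW/classU_gt0.
have PLV : (0 < Psi Lam^-1)%R by apply: classU_gt0 => //; rewrite invr_gt0.
set K := (Kd * Ku * Psi Lam^-1)%R.
have K0 : (0 <= K)%R.
  by apply/ltW; rewrite !mulr_gt0// (lt_le_trans ltr01).
have prodc : (0 < C ^+ n * (\prod_(i < n) c i) * Lam)%R.
  by rewrite !mulr_gt0 ?exprn_gt0// prodr_gt0.
apply: (@le_trans _ _ (\int[mu]_x (zsum (fun k =>
    (K * Psi (lam k) * \1_(EE g (lam k)) x)%:E) * (omega x)%:E))).
  apply: ge0_le_integralT => x.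
    apply: mule_ge0; last by rewrite lee_fin (pweight_ge0 womega).
    apply: (ext_ge0 gPsi); apply: mule_ge0; first exact: maximal_ge0.
    by rewrite inve_ge0 lee_fin ltW.
  apply: lee_wpmul2r; first by rewrite lee_fin (pweight_ge0 womega).
  apply: (le_trans (Psi_maximal_le mf c0 Lam0 Kd1 KdP Ku1 KuP x)).
  rewrite -zsumZ// => [|k]; last by rewrite lee_fin mulr_ge0.
  by apply/eq_leW; congr zsum; apply/funext => k; rewrite -EFinM mulrA.
rewrite (zsum_mass mu); last 4 first.
- by move=> k; rewrite mulr_ge0.
- by move=> k; exact: (measurable_product_superlevel mu vQ).
- exact: pweight_meas.
- exact: pweight_ge0.
rewrite (_ : zsum _ = K%:E * zsum (fun k => (Psi (lam k))%:E *
    \int[mu]_(x in EE g (lam k)) (omega x)%:E)); last first.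
  rewrite -zsumZ// => [|k]; last first.
    by apply: mule_ge0; [rewrite lee_fin|apply: mass_ge0; exact: pweight_ge0].
  by congr zsum; apply/funext => k; rewrite muleA -EFinM.
rewrite [leRHS]EFinM; apply: lee_wpmul2l => //.
have CC : (1 <= C ^+ 2)%R by rewrite exprn_ege1// ltW.
have cQ k : valid k -> cubes (Q k) by move=> lk; exact: cubes_cube.
have cQ' k : valid k -> cubes (Q' k) by move=> lk; exact: cubes_triple.
apply: (@modular_omega _ _ _ mu valid Q Q' vQ sigma (pweight_meas ws) (pweight_ge0 ws)
  _ (C ^+ 2)%R CC _ _ omega n Phis Psi Phi L A g (pweight_meas womega) (pweight_ge0 womega)
  n0 UPhis UPsi Phi_ginvK hPhiinv hincr phisL _ A0 mg g0 Hmod).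
- by move=> k /cQ; exact: wmassE.
- by move=> k /cQ'; exact: wmassE.
- by move=> k lk; exact: (wmass_triple C1 dC).
- move=> k /cQ' cQk m mE.
  have [m' m'0] := wmassE ws cQk.
  rewrite /wmass mE => -[mm']; rewrite -mm' in m'0.
  by have := HA _ cQk; rewrite [wmass sigma _]mE inver gt_eqF.
Qed.

End upper.
End positive_case.

(** * The two bounds *)

Section bounds.
Context {R : realType} {d n : nat}.
Local Notation mu := (leb R d).
Local Open Scope ereal_scope.
Hypothesis n0 : (0 < n)%N.
Variables (Phis : 'I_n -> R -> R) (Psi Phi : R -> R) (sigma : Rd R d -> R).
Hypothesis UPhis : forall i, classU (Phis i).
Hypothesis nPhis : forall i, nabla2 (Phis i).
Hypothesis UtPsi : classUtilde Psi.
Hypothesis hPhi : set_bij Rplus Rplus Phi.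
Hypothesis hPhiinv : forall y : R, (0 <= y)%R ->
      ginv Phi y = (\prod_(i < n) ginv (Phis i) y)%R.
Hypothesis hincr : forall s t : R, (0 < s -> s <= t -> Psi s / Phi s <= Psi t / Phi t)%R.
Hypothesis ws : positive_weight sigma.
Hypothesis dsigma : doubling sigma.
Local Notation sigmas := (fun _ : 'I_n => sigma).

Let UPsi : classU Psi.
Proof. by case: UtPsi => q q1 [Uq _ _]; exists q. Qed.
Let gPsi := classU_growth UPsi.
Let DPsi : Delta' Psi. Proof. by case: UtPsi => q q1 []. Qed.

Lemma Mconst_positive omega : Mconst Phi Phis Psi sigmas omega =
  ereal_sup [set wmass omega Q * ext Psi (ext (ginv Phi) (wmass sigma Q)^-1) | Q in cubes].
Proof.
rewrite /Mconst; congr ereal_sup; congr (_ @` _).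
have -> // : nu Phi Phis sigmas = sigma.
by apply/funext => x; exact: nu_positive.
Qed.

Lemma ext_cube Q : cubes Q -> exists2 m : R, (0 < m)%R & wmass sigma Q = m%:E /\
  ext Psi (ext (ginv Phi) (wmass sigma Q)^-1) = (Psi (ginv Phi m^-1))%:E.
Proof.
move=> /(wmassE ws)[m m0 mE]; exists m => //; split => //.
by rewrite mE inver gt_eqF.
Qed.

Lemma Psi_cube_gt0 (m : R) : (0 < m)%R -> (0 < Psi (ginv Phi m^-1))%R.
Proof.
move=> m0; apply: classU_gt0 => //; apply: (Phi_ginv_gt0 UPhis hPhiinv).
by rewrite invr_gt0.
Qed.

Lemma Mconst_gt0 omega : positive_weight omega ->
  0 < Mconst Phi Phis Psi sigmas omega.
Proof.
move=> womega; rewrite Mconst_positive.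
have cQ := @cubes_cube R d [tuple 0%R | _ < d] 1 ltr01.
apply: lt_le_trans (ereal_sup_ubound _); last by eexists; [exact: cQ|].
have [m m0 [_ ->]] := ext_cube cQ.
by rewrite mule_gt0 ?wmass_gt0// lte_fin Psi_cube_gt0.
Qed.

(** The functions are divided by [2 l_i B], where [l_i] exceeds their norms and [B]
    is the constant required of the modulars; [M f] is then divided by the norm
    [kappa * Psi^-1 A] that is sought, and [l_i] tends to the norm of [f_i]. *)
Lemma maximal_bounded : exists2 kappa : R, (0 < kappa)%R &
  forall omega, positive_weight omega -> forall A : R,
  Mconst Phi Phis Psi sigmas omega = A%:E ->
  bound_const (maximal sigmas) Phis sigmas Psi omega (kappa * ginv Psi A).
Proof.
have [C C1 dC] := dsigma.
have C0 : (0 < C)%R by exact: lt_trans C1.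
have [a [l rat]] := @rational_cubes R d.
have [L L0 phisL] := levels_exist UPhis nPhis.
have [K2 K20 K2P] := classUtilde_inv UtPsi.
have [Kd Kd1 KdP] := Delta'_bound UPsi DPsi.
have [|Ku Ku1 KuP] := @classU_upper _ _ UPsi (expR L ^+ n)%R.
  by rewrite exprn_ege1// -expR0 ler_expR ltW.
have Kd0 : (0 < Kd)%R by exact: lt_le_trans Kd1.
have Ku0 : (0 < Ku)%R by exact: lt_le_trans Ku1.
pose B : R := (2 * (C ^+ 2) ^+ 2 * n%:R)%R.
have B1 : (1 <= B)%R.
  have n1 : (1 <= n%:R :> R)%R by rewrite ler1n.
  have C4 : (1 <= (C ^+ 2) ^+ 2)%R by rewrite !exprn_ege1// ltW.
  by rewrite /B; nra.
have B0 : (0 < B)%R by exact: lt_le_trans B1.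
(* With [Lam = k0 * Psi^-1 A], convexity gives [Psi Lam >= k0 * A], which outweighs
   the constants [Kd * Ku * K2] of the modular bound. *)
pose k0 := (1 + Kd * Ku * K2)%R.
have k01 : (1 <= k0)%R by rewrite lerDl !mulr_ge0// ltW.
have k00 : (0 < k0)%R by exact: lt_le_trans k01.
pose kap := (C ^+ n * (2 * B) ^+ n * k0)%R.
have B20 : (0 < 2 * B)%R by apply: mulr_gt0.
have kap0 : (0 < kap)%R.
  by apply: mulr_gt0 => //; apply: mulr_gt0; exact: exprn_gt0.
exists kap => // omega womega A MA.
have A0 : (0 < A)%R by rewrite -lte_fin -MA; exact: Mconst_gt0.
have gA0 : (0 < ginv Psi A)%R by exact: ginv_gt0.
split; first by rewrite mulr_gt0.
move=> f Lf.
pose r i := fine (luxC (Phis i) sigma (f i)).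
have rE i : luxC (Phis i) sigma (f i) = (r i)%:E.
  rewrite /r fineK// ge0_fin_numE; last exact: lux_ge0.
  by case: (Lf i).
have r0 i : (0 <= r i)%R by rewrite -lee_fin -rE; exact: lux_ge0.
under eq_bigr => i _ do rewrite rE.
rewrite prodEFin -EFinM.
apply: le_prod_perturb => // [|lr rl]; first by rewrite ltW// mulr_gt0.
have scale i := @modular_scale R d (Phis i) sigma (f i) (lr i) B (UPhis i) ws
  (proj1 (Lf i)).
have luxl i : luxC (Phis i) sigma (f i) < (lr i)%:E by rewrite rE lte_fin.
have l0 i : (0 < lr i)%R by case: (scale i (luxl i) B1).
have Hmod i := proj2 (scale i (luxl i) B1).
pose Lam := (k0 * ginv Psi A)%R.
have Lam0 : (0 < Lam)%R by exact: mulr_gt0.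
have c0 i : (0 < 2 * lr i * B)%R by apply: mulr_gt0 => //; exact: mulr_gt0.
have HA Q : cubes Q -> wmass omega Q *
    ext Psi (ext (ginv Phi) (wmass sigma Q)^-1) <= A%:E.
  by move=> cQ; rewrite -MA Mconst_positive; apply: ereal_sup_ubound; exists Q.
rewrite (_ : kap * _ * _ = C ^+ n * (\prod_(i < n) (2 * lr i * B)) * Lam)%R; last first.
  have -> : (\prod_(i < n) (2 * lr i * B) = (2 * B) ^+ n * \prod_(i < n) lr i)%R.
    rewrite -[X in (_ ^+ X)%R](card_ord n) -prodr_const -big_split/=.
    by apply: eq_bigr => i _; ring.
  by rewrite /kap /Lam; ring.
apply: lux_le.
  apply: mulr_gt0 => //; apply: mulr_gt0; first exact: exprn_gt0.
  by apply: prodr_gt0 => i _; exact: c0.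
apply: (le_trans (integral_maximal_le n0 UPhis UtPsi hPhi hPhiinv hincr ws rat C1 dC L0
  phisL (fun i => proj1 (Lf i)) c0 Lam0 Kd1 KdP Ku1 KuP womega (ltW A0) HA Hmod)).
rewrite lee_fin.
have PLam : (k0 * A <= Psi Lam)%R.
  rewrite -{1}(ginvK gPsi (ltW A0)) /Lam; apply: classU_scale => //; exact: ltW.
have PLV : (0 <= Psi Lam^-1)%R.
  by apply: (growth_ge0 gPsi); rewrite invr_ge0 ltW.
have h1 := ler_wpM2r PLV PLam; have h2 := K2P _ Lam0.
have h3 : (k0 * (Psi Lam^-1 * A) <= K2)%R by nra.
rewrite -(ler_pM2l k00) mulr1 -!mulrA.
have : (Kd * Ku * (k0 * (Psi Lam^-1 * A)) <= Kd * Ku * K2)%R.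
  by rewrite ler_pM2l// mulr_gt0.
rewrite /k0; nra.
Qed.

(** Testing on the [f_i = Phi_i^-1 (1 / sigma Q) 1_Q], of norm at most [1]: on [Q]
    the maximal function is at least the product of these values, namely
    [Phi^-1 (1 / sigma Q)]. *)
Lemma bounded_Mconst : exists2 K : R, (0 < K)%R &
  forall omega, positive_weight omega -> forall C0 : R,
  bound_const (maximal sigmas) Phis sigmas Psi omega C0 ->
  Mconst Phi Phis Psi sigmas omega <= (K * Psi (2 * C0)%R)%:E.
Proof.
have [Kd Kd1 KdP] := Delta'_bound UPsi DPsi.
have Kd0 : (0 < Kd)%R by exact: lt_le_trans Kd1.
exists Kd => // omega womega C0 [C00 HC].
rewrite Mconst_positive; apply: ge_ereal_sup => _ [Q cQ <-].
have mQ := measurable_cubes cQ.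
have [m m0 [mE ->]] := ext_cube cQ.
have mV0 : (0 < m^-1)%R by rewrite invr_gt0.
pose t i := ginv (Phis i) m^-1.
have t0 i : (0 < t i)%R by exact: ginv_gt0.
pose f i (x : Rd R d) : R[i] := ((t i * \1_Q x)%:C)%C.
have modf i x : modulus (f i) x = (t i * \1_Q x)%R.
  rewrite /modulus /f /= expr0n/= addr0 sqrtr_sqr ger0_norm//.
  by rewrite mulr_ge0// ltW.
have mf i : Defs.measurableC (f i).
  split => /=; last exact: measurable_cst.
  by apply: measurable_funM; [exact: measurable_cst|exact: measurable_indic].
have s0 := pweight_ge0 ws; have o0 := pweight_ge0 womega.
have lux1 i : luxC (Phis i) sigma (f i) <= 1.
  apply: lux_le => //.
  rewrite (_ : \int[mu]_x _ = (m^-1)%:E * wmass sigma Q).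
    by rewrite mE -EFinM mulVf ?gt_eqF.
  rewrite -(massZ mu (pweight_meas ws) s0 mQ (ltW mV0)).
  rewrite [RHS]integral_mkcond; apply: eq_integral => x _.
  rewrite dive_EFin// invr1 mul1e /= modf patchE indicE.
  case: ifP => xQ; last by rewrite mulr0 (growth0 (classU_growth (UPhis i))) mul0e.
  by rewrite mulr1 (ginvK (classU_growth (UPhis i)) (ltW mV0)) EFinM.
have Lf i : LPhi (Phis i) sigma (f i).
  by split; [exact: mf|exact: (le_lt_trans (lux1 i) (ltry _))].
have lux2 : lux Psi omega (maximal sigmas f) < (2 * C0)%:E.
  apply: le_lt_trans (HC f Lf) _.
  apply: (@le_lt_trans _ _ C0%:E); last by rewrite lte_fin; lra.
  rewrite -[leRHS]mule1; apply: lee_wpmul2l; first by rewrite lee_fin ltW.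
  apply: (@le_trans _ _ (\prod_(i < n) 1%:E)); last by rewrite prodEFin big1.
  by apply: prode_le => i; [exact: lux_ge0|exact: lux1].
have [r [r0]] := lux_lt lux2; rewrite lte_fin => rC Hr.
have bE : ginv Phi m^-1 = (\prod_(i < n) t i)%R by rewrite hPhiinv// ltW.
set b := ginv Phi m^-1 in bE *.
have b0 : (0 < b)%R by rewrite bE prodr_gt0.
have Mb x : Q x -> b%:E <= maximal sigmas f x.
  move=> Qx; apply: le_ereal_sup_tmp; eexists; first by exists Q.
  rewrite bE -prodEFin; apply: prode_le => i; first by rewrite lee_fin ltW.
  have -> : (\1_Q x = 1 :> R)%R by rewrite indicE mem_set.
  rewrite mul1e.
  rewrite (_ : \int[mu]_(y in Q) _ = (t i)%:E * wmass sigma Q).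
    by rewrite mE inver gt_eqF// -!EFinM lee_fin mulrCA mulVf ?gt_eqF// mulr1.
  rewrite -(massZ mu (pweight_meas ws) s0 mQ (ltW (t0 i))).
  by apply: eq_integral => y yQ; rewrite modf indicE yQ mulr1.
have PbrM : (0 <= Psi (b / r))%R.
  by apply: (growth_ge0 gPsi); rewrite divr_ge0// ltW.
have h1 : wmass omega Q * (Psi (b / r))%:E <= 1.
  apply: le_trans Hr; rewrite muleC -(massZ mu (pweight_meas womega) o0 mQ PbrM).
  rewrite integral_mkcond; apply: ge0_le_integralT => x.
    by rewrite patchE; case: ifP => // _; rewrite lee_fin mulr_ge0.
  have M0 : 0 <= maximal sigmas f x / r%:E.
    by rewrite dive_EFin// mule_ge0 ?lee_fin ?invr_ge0 ?(ltW r0)// maximal_ge0.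
  rewrite patchE; case: ifPn => [|_]; last first.
    by rewrite mule_ge0 ?lee_fin//; exact: (ext_ge0 gPsi).
  rewrite inE => /Mb bM; rewrite EFinM; apply: lee_wpmul2r; first by rewrite lee_fin.
  rewrite -[leLHS]/(ext Psi (b / r)%:E); apply: (growth_ext_le gPsi).
    by rewrite lee_fin divr_ge0// ltW.
  rewrite dive_EFin// mulrC EFinM; apply: lee_wpmul2l => //.
  by rewrite lee_fin invr_ge0 ltW.
have [w w0 wE] := wmassE womega cQ.
move: h1; rewrite wE -!EFinM !lee_fin => h1.
have br0 : (0 <= b / r)%R by rewrite divr_ge0// ltW.
have h2 : (Psi b <= Kd * Psi (b / r) * Psi r)%R.
  by rewrite -{1}(divfK (lt0r_neq0 r0) b); exact: KdP.
have h3 : (Psi r <= Psi (2 * C0))%R by apply: (growth_le gPsi); exact: ltW.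
have P0 : (0 <= Psi r)%R by apply: (growth_ge0 gPsi); exact: ltW.
apply: (@le_trans _ _ (w * (Kd * Psi (b / r) * Psi r))%R); first by rewrite ler_pM2l.
rewrite (_ : w * _ = Kd * ((w * Psi (b / r)) * Psi r))%R; last by ring.
rewrite ler_pM2l//; apply: le_trans h3.
by rewrite -[leRHS]mul1r ler_wpM2r.
Qed.

End bounds.

(** * General weights and conclusion *)

Lemma measurable_make_positive disp (T : measurableType disp) (R : realType)
  (s : T -> R) : measurable_fun setT s ->
  measurable_fun setT (fun x => if 0 < s x then s x else 1).
Proof.
move=> ms; apply: measurable_fun_ifT => //.
by apply: measurable_fun_ltr.
Qed.

Section positive_version.
Context {R : realType} {d : nat}.
Local Notation mu := (leb R d).
Implicit Types (s : Rd R d -> R).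
Local Open Scope ereal_scope.

Definition eq_off_null s s' :=
  exists N, [/\ measurable N, mu N = 0 & forall x, ~ N x -> s x = s' x].

Lemma weight_positive_version s : weight s ->
  exists2 s', positive_weight s' & eq_off_null s s'.
Proof.
move=> [ms ls [N [mN N0 sN]]].
pose s' x : R := if (0 < s x)%R then s x else 1%R.
have ss' x : ~ N x -> s x = s' x.
  move=> xN; rewrite /s'; case: ltP => // sx0.
  by exfalso; apply: xN; apply: sN => /=; apply/negP; rewrite -leNgt.
have ms' : measurable_fun setT s' by exact: measurable_make_positive.
exists s'; last by exists N.
split => //; last by move=> x; rewrite /s'; case: ifP.
move=> Q cQ; have [_ iQ] := integrableP _ _ _ (ls Q cQ).
apply/integrableP; split; first exact: measurable_mass.
rewrite (integral_off_null (g := fun x => `|(s x)%:E|) _ mN N0)//.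
by move=> x /ss' /= ->.
Qed.

Section same.
Variables s s' : Rd R d -> R.
Hypothesis ss' : eq_off_null s s'.

Lemma same_wmass : wmass s = wmass s'.
Proof.
have [N [mN N0 sN]] := ss'; apply/funext => E.
by apply: (integral_off_null _ mN N0) => x /sN ->.
Qed.

Lemma same_lux Psi : lux Psi s = lux Psi s'.
Proof.
have [N [mN N0 sN]] := ss'; apply/funext => g.
have E : (fun l : R => \int[mu]_x (ext Psi (g x / l%:E) * (s x)%:E)) =
    (fun l : R => \int[mu]_x (ext Psi (g x / l%:E) * (s' x)%:E)).
  apply/funext => l.
  by apply: (integral_off_null _ mN N0) => x /sN ->.
exact: (congr1 (fun F : R -> \bar R =>
  ereal_inf [set l%:E | l in [set l : R | (0 < l)%R /\ F l <= 1]]) E).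
Qed.

Lemma same_maximal n : maximal (fun _ : 'I_n => s) = maximal (fun=> s').
Proof.
have [N [mN N0 sN]] := ss'; apply/funext => f; apply/funext => x.
rewrite /maximal; congr (ereal_sup (_ @` _)); apply/funext => Q.
apply: eq_bigr => i _; rewrite same_wmass; congr (_ * _).
by apply: (integral_off_null _ mN N0) => y /sN ->.
Qed.

Lemma same_nu n Phi (Phis : 'I_n -> R -> R) :
  eq_off_null (nu Phi Phis (fun=> s)) (nu Phi Phis (fun=> s')).
Proof.
have [N [mN N0 sN]] := ss'; exists N; split => // x /sN sx.
by rewrite /nu sx.
Qed.

End same.

Lemma same_Mconst n Phi (Phis : 'I_n -> R -> R) Psi s s' w w' :
  eq_off_null s s' -> eq_off_null w w' ->
  Mconst Phi Phis Psi (fun=> s) w = Mconst Phi Phis Psi (fun=> s') w'.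
Proof.
move=> ss' ww'; rewrite /Mconst (same_wmass ww').
by rewrite (same_wmass (same_nu ss' Phi Phis)).
Qed.

Lemma same_bound_const n (Phis : 'I_n -> R -> R) Psi s s' w w' :
  eq_off_null s s' -> eq_off_null w w' ->
  bound_const (maximal (fun=> s)) Phis (fun=> s) Psi w =
  bound_const (maximal (fun=> s')) Phis (fun=> s') Psi w'.
Proof.
move=> ss' ww'; apply/funext => C0.
rewrite /bound_const (same_maximal ss') (same_lux ww').
have luxE i : luxC (Phis i) s = luxC (Phis i) s'.
  by rewrite /luxC (same_lux ss').
have LE i : LPhi (Phis i) s = LPhi (Phis i) s' by rewrite /LPhi luxE.
apply/propext; split => -[C00 H]; split; try exact: C00.
- move=> f Lf; rewrite -(eq_bigr _ (fun i _ => congr1 (@^~ (f i)) (luxE i))).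
  by apply: H => i; rewrite LE; exact: Lf.
- move=> f Lf; rewrite (eq_bigr _ (fun i _ => congr1 (@^~ (f i)) (luxE i))).
  by apply: H => i; rewrite -LE; exact: Lf.
Qed.

End positive_version.

Theorem corollary3p5 (R : realType) (d n : nat) (hd : (0 < d)%N) (hn : (0 < n)%N)
    (sigma : Rd R d -> R) (Phis : 'I_n -> R -> R) (Psi Phi : R -> R)
    (hsigma : weight sigma)
    (hPhis : forall i, classU (Phis i) /\ nabla2 (Phis i))
    (hPsi : classUtilde Psi)
    (hPhi : set_bij Rplus Rplus Phi)
    (hPhiinv : forall y : R, 0 <= y ->
      ginv Phi y = \prod_(i < n) ginv (Phis i) y)
    (hincr : forall s t : R, 0 < s -> s <= t -> Psi s / Phi s <= Psi t / Phi t)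
    (hdoubling : doubling sigma) :
  let sigmas := fun _ : 'I_n => sigma in
  exists2 c : R, 0 < c & forall omega : Rd R d -> R, weight omega ->
    let A := Mconst Phi Phis Psi sigmas omega in
    let N := opnorm (maximal sigmas) Phis sigmas Psi omega in
    ((A < +oo)%E <-> bounded_op (maximal sigmas) Phis sigmas Psi omega) /\
    ((c^-1)%:E * ext (ginv Psi) A <= N <= c%:E * ext (ginv Psi) A)%E.
Proof.
move=> sigmas.
have UPhis i := proj1 (hPhis i); have nPhis i := proj2 (hPhis i).
have UPsi : classU Psi by case: hPsi => q q1 [Uq _ _]; exists q.
have gPsi := classU_growth UPsi.
have [s' ps' ss'] := weight_positive_version hsigma.
have ds' : doubling s' by move: hdoubling; rewrite /doubling (same_wmass ss').
have [kap kap0 upper] := maximal_bounded hn UPhis nPhis hPsi hPhi hPhiinv hincr ps' ds'.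
have [K K0 lower] := bounded_Mconst UPhis hPsi hPhi hPhiinv ps'.
pose c := 1 + kap + 2 * (1 + K).
have c0 : 0 < c by rewrite /c; lra.
exists c => // omega womega.
have [w' pw' ww'] := weight_positive_version womega.
rewrite /bounded_op /opnorm /sigmas (same_Mconst _ _ _ ss' ww') (same_bound_const _ _ ss' ww').
have A0 := Mconst_gt0 UPhis hPsi hPhi hPhiinv ps' pw'.
have {}upper := upper w' pw'; have {}lower := lower w' pw'.
set A := Mconst _ _ _ _ _ in A0 upper lower *.
split; first split.
- case: A A0 upper lower => // A A0 upper _ _.
  by exists (kap * ginv Psi A); exact: upper.
- by move=> [C0 /lower]; move/le_lt_trans; apply; rewrite ltry.
apply/andP; split.
- apply: le_ereal_inf_tmp => _ [C0 bC <-]; have C00 := proj1 bC.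
  have := lower _ bC; case: A A0 {upper lower} => // A; rewrite lte_fin lee_fin => A0 AK.
  rewrite /= -EFinM lee_fin.
  have c2 : 0 <= 2 * C0 by rewrite mulr_ge0// ltW.
  have P2 : 0 <= Psi (2 * C0) by exact: growth_ge0.
  rewrite ler_pdivrMl//.
  apply: (@le_trans _ _ ((1 + K) * (2 * C0))); last by rewrite /c; nra.
  apply: (@le_trans _ _ (ginv Psi ((1 + K) * Psi (2 * C0)))).
    apply: ginv_le => //; first exact: ltW.
    by apply: (le_trans AK); apply: ler_wpM2r => //; rewrite lerDr.
  apply: (le_trans (ginv_scale UPsi _ P2)); first by rewrite lerDl ltW.
  by rewrite ginvVK.
- case: A A0 upper {lower} => // [A|_ _]; last by rewrite /= gt0_muley ?leey// lte_fin.
  rewrite lte_fin => A0 upper; have := upper A erefl => bA.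
  apply: (@le_trans _ _ (kap * ginv Psi A)%:E).
    by apply: ereal_inf_lbound; exists (kap * ginv Psi A).
  rewrite /= -EFinM lee_fin ler_wpM2r//.
    by apply: ginv_ge0 => //; exact: ltW.
  by rewrite /c; lra.
Qed.
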